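(* Let $n\ge 1$ and let $\mathscr{S}=\mathscr{S}(\mathbb{R}^n,\mathbb{R})$. The linear operators $\mathscr{F}_{\mathbb{R}} : \mathscr{S}\to\mathscr{S}$ (real Fourier transform) and $\mathscr{F}_{\mathbb{R}}^{a} : \mathscr{S}\to\mathscr{S}$ (real Fourier anti-transform) are (linear) isomorphisms, and $$\mathscr{F}_{\mathbb{R}}^{a}\circ\mathscr{F}_{\mathbb{R}}=\mathrm{Id},\qquad \mathscr{F}_{\mathbb{R}}\circ\mathscr{F}_{\mathbb{R}}^{a}=\mathrm{Id},$$ where $\mathrm{Id}$ is the identity operator on $\mathscr{S}$.
   Context: $\mathscr{S}=\mathscr{S}(\mathbb{R}^n,\mathbb{R})$ is the real vector space of real-valued Schwartz functions (smooth functions of rapid decrease) on $\mathbb{R}^n$; $\cdot$ is the Euclidean inner product. Let $$\mathscr{S}_{sa}=\{(g_1,g_2)\in\mathscr{S}\oplus\mathscr{S} : g_1(\mathbf{x})=g_1(-\mathbf{x}),\ g_2(\mathbf{x})=-g_2(-\mathbf{x})\ \ \forall\,\mathbf{x}\in\mathbb{R}^n\}.$$ Define $\mathcal{F}:\mathscr{S}\to\mathscr{S}_{sa}$, $\mathcal{F}[f]=(\mathcal{F}_1[f],\mathcal{F}_2[f])$, by $$\mathcal{F}_1[f](\mathbf{y})=\frac{1}{\sqrt{(2\pi)^n}}\int_{\mathbb{R}^n} f(\mathbf{x})\cos(\mathbf{y}\cdot\mathbf{x})\,d\mathbf{x},\qquad \mathcal{F}_2[f](\mathbf{y})=-\frac{1}{\sqrt{(2\pi)^n}}\int_{\mathbb{R}^n}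 f(\mathbf{x})\sin(\mathbf{y}\cdot\mathbf{x})\,d\mathbf{x},$$ and $\mathcal{F}_a:\mathscr{S}_{sa}\to\mathscr{S}$ by $$\mathcal{F}_a[f_1,f_2](\mathbf{x})=\frac{1}{\sqrt{(2\pi)^n}}\int_{\mathbb{R}^n}\big(f_1(\mathbf{y})\cos(\mathbf{y}\cdot\mathbf{x})-f_2(\mathbf{y})\sin(\mathbf{y}\cdot\mathbf{x})\big)\,d\mathbf{y}.$$ Define the sum operator $S:\mathscr{S}_{sa}\to\mathscr{S}$, $S[g_1,g_2](\mathbf{x})=g_1(\mathbf{x})+g_2(\mathbf{x})$, and the parity decomposition operator $D:\mathscr{S}\to\mathscr{S}_{sa}$, $$D[g](\mathbf{x})=\Big(\tfrac12\big(g(\mathbf{x})+g(-\mathbf{x})\big),\ \tfrac12\big(g(\mathbf{x})-g(-\mathbf{x})\big)\Big).$$ The real Fourier transform and real Fourier anti-transform are the operators $\mathscr{S}\to\mathscr{S}$ defined by $$\mathscr{F}_{\mathbb{R}}=S\circ\mathcal{F},\qquad \mathscr{F}_{\mathbb{R}}^{a}=\mathcal{F}_a\circ D.$$ *)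

(* Defs.v *)
From HB Require Import structures.
From mathcomp Require Import all_boot all_order all_algebra.
From mathcomp Require Import all_classical all_reals all_analysis.

Set Implicit Arguments.
Unset Strict Implicit.
Unset Printing Implicit Defensive.

Import Order.TTheory GRing.Theory Num.Theory.
Import numFieldNormedType.Exports.

Local Open Scope classical_set_scope.
Local Open Scope ring_scope.

Section LebesgueMeasureRn.
Variable R : realType.
Local Open Scope ereal_scope.

(* The domain factor uses measurableTypeR, the copy of R on which the library's
   lebesgue_measure is defined; its measurable sets are those of R. *)
Definition tcons n (p : measurableTypeR R * n.-tuple R) : n.+1.-tuple R :=
  [tuple of p.1 :: p.2].

Lemma measurable_tcons n : measurable_fun setT (@tcons n).
Proof. exact: (measurable_cons measurable_fst measurable_snd). Qed.

Section step.
Variables (n : nat) (m : {sigma_finite_measure set n.-tuple R -> \bar R}).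

Definition lebesgue_step : set (n.+1.-tuple R) -> \bar R :=
  pushforward (@lebesgue_measure R \x m) (@tcons n).

Let mu : {measure set n.+1.-tuple R -> \bar R} :=
  measure_function_pushforward__canonical__measure_function_Measure
    (@lebesgue_measure R \x m) (@measurable_tcons n).

Let step0 : lebesgue_step set0 = 0.
Proof. exact: (measure0 mu). Qed.

Let step_ge0 A : 0 <= lebesgue_step A.
Proof. exact: (measure_ge0 mu). Qed.

Let step_sigma_additive : semi_sigma_additive lebesgue_step.
Proof. exact: (@measure_semi_sigma_additive _ _ _ mu). Qed.

HB.instance Definition _ :=
  isMeasure.Build _ _ _ lebesgue_step step0 step_ge0 step_sigma_additive.

Lemma lebesgue_step_sigma_finite : sigma_finite setT lebesgue_step.
Proof.
have /sigma_finiteP[F [FT ndF Foo]] := sigma_finiteT (@lebesgue_measure R).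
have /sigma_finiteP[G [GT ndG Goo]] := sigma_finiteT m.
pose g (t : n.+1.-tuple R) : measurableTypeR R * n.-tuple R :=
  (thead t, [tuple of behead t]).
have mg : measurable_fun setT g.
  by apply: measurable_fun_pair; [exact: measurable_tnth|exact: measurable_behead].
have gK : cancel (@tcons n) g.
  by move=> [x t]; rewrite /g /tcons theadE; congr (_, _); exact: val_inj.
exists (fun k => g @^-1` (F k `*` G k)).
  apply/esym; rewrite -subTset => t _ /=.
  have [i _ Fi] : (\bigcup_i F i) (thead t) by rewrite -FT.
  have [j _ Gj] : (\bigcup_j G j) [tuple of behead t] by rewrite -GT.
  exists (maxn i j) => //; split => /=.
  - by apply: (subsetPset _ _ (ndF _ _ (leq_maxl i j))).
  - by apply: (subsetPset _ _ (ndG _ _ (leq_maxr i j))).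
move=> k; have [mF Fk] := Foo k; have [mG Gk] := Goo k; split.
  by rewrite -[X in measurable X]setTI; apply: mg => //; exact: measurableX.
rewrite /lebesgue_step /pushforward -comp_preimage.
rewrite (_ : g \o @tcons n = id) ?preimage_id; last by apply/funext => p /=; rewrite gK.
by rewrite product_measure1E// lte_mul_pinfty// ge0_fin_numE.
Qed.

HB.instance Definition _ :=
  Measure_isSigmaFinite.Build _ _ _ lebesgue_step lebesgue_step_sigma_finite.

End step.

(* Lebesgue measure on (the Borel sets of) R^n as the n-fold product of the
   one-dimensional one, on the library's measurable type n.-tuple R; its values
   on boxes are given by lebesgue_measure_tuple_box. *)
Fixpoint lebesgue_measure_tuple n : {sigma_finite_measure set n.-tuple R -> \bar R} :=
  match n with
  | 0 => \d_([tuple] : 0.-tuple R)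
  | n'.+1 => lebesgue_step (lebesgue_measure_tuple n')
  end.

Lemma lebesgue_measure_tuple_box n (A : 'I_n -> set R) :
  (forall i, measurable (A i)) ->
  lebesgue_measure_tuple n [set t | forall i, A i (tnth t i)] =
  \prod_(i < n) lebesgue_measure (A i).
Proof.
elim: n A => [|n IH] A mA.
  rewrite big_ord0 /= diracE mem_set//.
  by move=> /= -[].
rewrite big_ord_recl -IH; last by move=> i; exact: mA.
rewrite /= /lebesgue_step /pushforward -product_measure1E.
-   congr (_ _); apply/seteqP; split => -[x t] /=.
    move=> H; split; first by have := H ord0.
    by move=> i; have := H (lift ord0 i); rewrite tnthS.
  move=> [H0 H] i; have [j ->|->] := unliftP ord0 i; last exact: H0.
  by rewrite tnthS; exact: H.
- exact: mA.
- have mB : measurable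
      (\bigcap_(i in [set: 'I_n]) ((@tnth n R ^~ i) @^-1` A (lift ord0 i))).
    apply: fin_bigcap_measurable => // i _.
    by rewrite -[X in measurable X]setTI; apply: measurable_tnth.
  move: mB; congr (measurable _); apply/seteqP.
  by split => t /= H i => [|_]; exact: H.
Qed.

End LebesgueMeasureRn.

Section SchwartzSpace.
Variables (R : realType) (n : nat).
Local Notation V := 'rV[R]_n.
Implicit Types f g : V -> R.

Definition partial (i : 'I_n) f : V -> R := fun x => 'D_(delta_mx 0 i) f x.

(* A sequence of indices rather than a multi-index: smooth functions have partial
   derivatives of all orders taken in any order, and every multi-index derivative
   is one of these. *)
Definition iter_partial (s : seq 'I_n) f : V -> R := foldr partial f s.

Definition smooth f := forall s : seq 'I_n,
  continuous (iter_partial s f) /\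
  forall i x, derivable (iter_partial s f) x (delta_mx 0 i).

Definition rapidly_decreasing f := forall (a : 'I_n -> nat) (s : seq 'I_n),
  exists C : R, forall x : V,
    `|(\prod_(i < n) x 0 i ^+ a i) * iter_partial s f x| <= C.

Definition schwartz : {pred V -> R} :=
  mem [set f | smooth f /\ rapidly_decreasing f].

Lemma iter_partial0 s : iter_partial s 0 = 0.
Proof.
elim: s => //= i s ->; apply/funext => x; exact: derive_cst.
Qed.

Lemma iter_partialZD (c : R) f g s : smooth f -> smooth g ->
  iter_partial s (c *: f + g) = c *: iter_partial s f + iter_partial s g.
Proof.
move=> sf sg; elim: s => //= i s ->; apply/funext => x.
have [_ df] := sf s; have [_ dg] := sg s.
by rewrite /partial deriveD ?deriveZ//; exact: derivableZ.
Qed.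

Lemma continuous_scale (c : R) f : continuous f -> continuous (c *: f : V -> R).
Proof.
move=> cf x; rewrite /continuous_at.
have := cvgM (cvg_cst c) (cf x).
exact.
Qed.

Lemma schwartz_submod_closed : submod_closed schwartz.
Proof.
split.
  rewrite inE; split=> [s|a s].
    rewrite iter_partial0; split=> [x|i x]; first exact: cst_continuous.
    exact: derivable_cst.
  by exists 0 => x; rewrite iter_partial0 mulr0 normr0.
move=> c f g; rewrite !inE => -[sf rf] [sg rg]; split=> [s|a s].
  rewrite iter_partialZD//; have [cf df] := sf s; have [cg dg] := sg s.
  split=> [x|i x]; last by apply: derivableD => //; exact: derivableZ.
  by apply: continuousD; [exact: continuous_scale|exact: cg].
have [C fC] := rf a s; have [D gD] := rg a s.
exists (`|c| * C + D) => x; rewrite iter_partialZD//=.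
rewrite mulrDr (le_trans (ler_normD _ _))// lerD//.
by rewrite mulrCA normrM ler_wpM2l.
Qed.

HB.instance Definition _ :=
  GRing.isSubmodClosed.Build R (V -> R) schwartz schwartz_submod_closed.

Lemma derive_reflect f (x v : V) : derivable f (- x) v ->
  derivable (f \o -%R) x v /\ 'D_v (f \o -%R) x = - 'D_v f (- x).
Proof.
move=> df.
suff H : (fun h : R => h^-1 *: (((f \o -%R) \o shift x) (h *: v) -
    (f \o -%R) x)) @ 0^' --> - 'D_v f (- x).
  by split; [apply/cvg_ex; eexists; exact: H|exact: cvg_lim H].
pose q (h : R) := h^-1 *: ((f \o shift (- x)) (h *: v) - f (- x)).
rewrite (_ : (fun h => _) = \- (q \o -%R)); last first.
  by apply/funext => h; rewrite /q /= invrN scaleNr opprK scaleNr opprD.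
apply: cvgN; apply: cvg_comp df.
move=> A [e /= e0 eA]; exists e => //= h /= he h0.
apply: eA; last by rewrite oppr_eq0.
by rewrite /= opprK add0r -normrN -sub0r.
Qed.

Lemma iter_partial_reflect f s : smooth f -> exists b : bool,
  iter_partial s (f \o -%R) = (-1) ^+ b *: (iter_partial s f \o -%R).
Proof.
move=> sf; elim: s => [|i s [b /= ->]] /=; first by exists false; rewrite scale1r.
exists (~~ b); apply/funext => x; have [_ df] := sf s.
have [dg eg] := derive_reflect (df i (- x)).
by rewrite /partial deriveZ// eg signrN scalerN scaleNr.
Qed.

Lemma schwartz_reflect f : f \in schwartz -> f \o -%R \in schwartz.
Proof.
rewrite !inE => -[sf rf]; split=> [s|a s].
  have [b ->] := iter_partial_reflect s sf; have [cf df] := sf s.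
  split=> [x|i x].
    apply: continuous_scale x => x; apply: continuous_comp; last exact: cf.
    exact: oppr_continuous.
  by apply: derivableZ; exact: (derive_reflect (df i (- x))).1.
have [b ->] := iter_partial_reflect s sf; have [C fC] := rf a s.
exists C => x; have := fC (- x).
rewrite (_ : ((-1) ^+ b *: (iter_partial s f \o -%R) : V -> R) x =
  (-1) ^+ b * iter_partial s f (- x))// !normrM normr_sign mul1r.
congr (_ * _ <= _); rewrite !normr_prod; apply: eq_bigr => i _.
by rewrite mxE !normrX normrN.
Qed.

Record schwartz_space :=
  SchwartzSpace {schwartz_fun :> V -> R; _ : schwartz_fun \in schwartz}.

HB.instance Definition _ := [isSub for schwartz_fun].
HB.instance Definition _ := [Choice of schwartz_space by <:].
HB.instance Definition _ := [SubChoice_isSubLmodule of schwartz_space by <:].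

Definition schwartz_sa_pred : {pred schwartz_space * schwartz_space} :=
  mem [set g : schwartz_space * schwartz_space |
    (forall x, g.1 x = g.1 (- x)) /\ (forall x, g.2 x = - g.2 (- x))].

Lemma schwartz_sa_submod_closed : submod_closed schwartz_sa_pred.
Proof.
split; first by rewrite inE; split=> x //=; rewrite oppr0.
move=> c f g; rewrite !inE => -[f1 f2] [g1 g2]; split=> x /=.
  by rewrite !fctE f1 g1.
by rewrite !fctE f2 g2 scalerN opprD.
Qed.

HB.instance Definition _ := GRing.isSubmodClosed.Build R
  (schwartz_space * schwartz_space)%type schwartz_sa_pred
  schwartz_sa_submod_closed.

Record schwartz_sa := SchwartzSa {
  schwartz_pair :> schwartz_space * schwartz_space;
  _ : schwartz_pair \in schwartz_sa_pred}.

HB.instance Definition _ := [isSub for schwartz_pair].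
HB.instance Definition _ := [Choice of schwartz_sa by <:].
HB.instance Definition _ := [SubChoice_isSubLmodule of schwartz_sa by <:].

Definition reflect (f : schwartz_space) : schwartz_space :=
  SchwartzSpace (schwartz_reflect (valP f)).

Lemma reflect_is_linear : linear reflect.
Proof. by move=> c f g; exact/val_inj. Qed.

HB.instance Definition _ :=
  GRing.isLinear.Build R schwartz_space schwartz_space _ reflect
    reflect_is_linear.

Definition parity_sum (g : schwartz_sa) : schwartz_space := g.1 + g.2.

Lemma parity_sum_is_linear : linear parity_sum.
Proof.
move=> c f g; rewrite /parity_sum /= scalerDr !addrA; congr (_ + _).
by rewrite -!addrA; congr (_ + _); rewrite addrC.
Qed.

HB.instance Definition _ :=
  GRing.isLinear.Build R schwartz_sa schwartz_space _ parity_sum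
    parity_sum_is_linear.

Definition parity_parts (g : schwartz_space) : schwartz_space * schwartz_space :=
  (2^-1 *: (g + reflect g), 2^-1 *: (g - reflect g)).

Lemma parity_parts_sa (g : schwartz_space) : parity_parts g \in schwartz_sa_pred.
Proof.
rewrite inE; split=> x /=; rewrite !fctE /= opprK.
  by rewrite addrC.
by rewrite -scalerN opprB.
Qed.

Definition parity_decomposition (g : schwartz_space) : schwartz_sa :=
  SchwartzSa (parity_parts_sa g).

Lemma parity_decomposition_is_linear : linear parity_decomposition.
Proof.
move=> c f g; apply/val_inj; rewrite /= /parity_parts linearP.
congr (_, _) => /=.
  by rewrite addrACA -scalerDr [LHS]scalerDr !scalerA mulrC.
by rewrite opprD addrACA -scalerBr [LHS]scalerDr !scalerA mulrC.
Qed.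

HB.instance Definition _ :=
  GRing.isLinear.Build R schwartz_space schwartz_sa _ parity_decomposition
    parity_decomposition_is_linear.

End SchwartzSpace.

Section RealFourier.
Variables (R : realType) (n : nat).
Local Notation V := 'rV[R]_n.

Definition dotv (x y : V) : R := \sum_(i < n) x 0 i * y 0 i.

(* Points of R^n are row vectors (where the topology and derivatives live) but
   the measure lives on n-tuples. *)
Definition integral_Rn (f : V -> R) : R :=
  \int[lebesgue_measure_tuple R n]_t f (\row_(i < n) tnth t i).

Definition fourier_cos (f : V -> R) : V -> R := fun y =>
  (Num.sqrt ((2 * pi) ^+ n))^-1 *
  integral_Rn (fun x => f x * cos (dotv y x)).

Definition fourier_sin (f : V -> R) : V -> R := fun y =>
  - (Num.sqrt ((2 * pi) ^+ n))^-1 *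
  integral_Rn (fun x => f x * sin (dotv y x)).

Definition fourier_anti (f1 f2 : V -> R) : V -> R := fun x =>
  (Num.sqrt ((2 * pi) ^+ n))^-1 *
  integral_Rn (fun y => f1 y * cos (dotv y x) - f2 y * sin (dotv y x)).

End RealFourier.

(* Main.v *)
(* Write [k t = cos t - sin t] and [H f y = \int f x k(y.x) dx] (the Hartley
   transform).  Up to the factor [(2 pi)^(-n/2)], both [S \o F] and [F_a \o D]
   equal [H], so everything reduces to: [H] preserves the Schwartz space and
   [H (H f) = (2 pi)^n f].  The first fact follows from
   [d_i (H f)(y) = - H (x_i f)(- y)] (a second-order Taylor bound on [k]) and
   [H (d_i f)(y) = y_i H f (- y)] (translation invariance of the integral).  For
   the second one, insert the Gaussian [G y = exp (- a |y|^2 / 2)] in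
   [H (H f) z] and exchange the integrals: [H G] solves a linear ODE along every
   line through [0], hence is a Gaussian of covariance [a Id], whose second
   moments are known by parts.  As [a] tends to [0], both errors are controlled
   by quadratic bounds, so dominated convergence is not needed. *)

Require Import Defs.
From HB Require Import structures.
From mathcomp Require Import all_boot all_order all_algebra.
From mathcomp Require Import all_classical all_reals all_analysis.
From mathcomp Require Import measurable_realfun.
From mathcomp Require Import ring lra.

Set Implicit Arguments.
Unset Strict Implicit.
Unset Printing Implicit Defensive.

Import Order.TTheory GRing.Theory Num.Theory.
Import numFieldNormedType.Exports.

Local Open Scope classical_set_scope.
Local Open Scope ring_scope.

(** * Lebesgue measure on tuples *)

Section LebesgueTuple.
Variable R : realType.
Local Notation leb := (@lebesgue_measure R).
Local Notation mu := (lebesgue_measure_tuple R).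
Local Open Scope ereal_scope.

(** The kernel [cos - sin] arises because adding the cosine and sine components integrates [f]
    against it. In the anti-transform the even part meets only [cos] and the odd part only [- sin];
    the missing cross terms are odd, so they integrate to zero. The normalised Hartley transform is
    its own inverse. The two required operators are therefore built from it as [D \o H] and
    [H \o S]: parity and smoothness of the components come from [D], and [S \o D = Id] collapses
    both composites of the theorem to one involution. The obstacle in [H (H f)] is that
    [f x * k (y.x) * k (z.y)] has no decay in [y], so Fubini does not apply until the Gaussian in
    [y] is present. Limits are replaced throughout by inequalities whose constants are integrals of
    explicit majorants. *)

Lemma tnth_tcons0 n (x : R) (t : n.-tuple R) : tnth (tcons (x, t)) ord0 = x.
Proof. by []. Qed.

Lemma tnth_tconsS n (x : R) (t : n.-tuple R) i :
  tnth (tcons (x, t)) (lift ord0 i) = tnth t i.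
Proof. by rewrite /tcons tnthS. Qed.

Lemma ge0_integral_tupleS n (f : n.+1.-tuple R -> \bar R) :
  measurable_fun setT f -> (forall t, 0 <= f t) ->
  \int[mu n.+1]_t f t = \int[leb]_x \int[mu n]_t f (tcons (x, t)).
Proof.
move=> mf f0.
have mft : measurable_fun setT (f \o @tcons R n).
  by apply: measurableT_comp => //; exact: measurable_tcons.
rewrite -(@fubini_tonelli1 _ _ _ _ _ leb (mu n) (f \o @tcons R n))//.
rewrite /= /lebesgue_step ge0_integral_pushforward ?preimage_setT//.
exact: measurable_tcons.
by move=> x; exact: f0.
Qed.

(** Invariance is phrased through integrals of nonnegative functions rather than measures of sets:
    this is the form that an induction on coordinates by Tonelli consumes. *)
Definition lebesgue_preserving (phi : R -> R) :=
  measurable_fun setT phi /\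
  forall f : R -> \bar R, measurable_fun setT f -> (forall x, 0 <= f x) ->
    \int[leb]_x f (phi x) = \int[leb]_x f x.

(** Lebesgue measure is determined by its values on half-open intervals, so it equals its
    pushforward by [phi]; change of variables carries this over to integrals. *)
Lemma lebesgue_preserving_of_ocitv (phi : R -> measurableTypeR R) :
  measurable_fun setT phi ->
  (forall a b : R, leb (phi @^-1` `]a, b]%classic) = leb `]a, b]%classic) ->
  lebesgue_preserving phi.
Proof.
move=> mphi hphi; split => // f mf f0.
pose pf : {measure set (measurableTypeR R) -> \bar R} :=
  measure_function_pushforward__canonical__measure_function_Measure leb mphi.
have E A : measurable A -> leb A = pf A.
  apply: lebesgue_measure_unique => _ [[a b] _ <-].
  by rewrite /= /pushforward hphi.
transitivity (\int[pf]_x f x); last first.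
  by apply: eq_measure_integral => A mA _; exact/esym/E.
by rewrite ge0_integral_pushforward.
Qed.

Lemma lebesgue_preserving_shift (a : R) : lebesgue_preserving (fun x => x + a)%R.
Proof.
apply: lebesgue_preserving_of_ocitv.
  by apply: measurable_funD => //; exact: measurable_cst.
move=> u v; rewrite (_ : _ @^-1` _ = `]u - a, v - a]%classic)%R; last first.
  by apply/seteqP; split => x /=; rewrite !in_itv/= ltrBlDr lerBrDr.
rewrite !lebesgue_measure_itv/= !lte_fin ltrD2r.
by congr (if _ then _ else _); rewrite -!EFinD; congr EFin; ring.
Qed.

Lemma lebesgue_preserving_opp : lebesgue_preserving -%R.
Proof.
apply: lebesgue_preserving_of_ocitv; first exact: oppr_measurable.
by move=> u v; exact: lebesgue_measureN.
Qed.

Definition tuple_map_coord n (phi : 'I_n -> R -> R) (t : n.-tuple R) : n.-tuple R :=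
  [tuple phi i (tnth t i) | i < n].

Lemma measurable_tuple_map_coord n (phi : 'I_n -> R -> R) :
  (forall i, measurable_fun setT (phi i)) ->
  measurable_fun setT (tuple_map_coord phi).
Proof.
move=> mphi; apply/measurable_fun_tnthP => i.
rewrite (_ : _ \o _ = phi i \o (@tnth n R ^~ i)).
  by apply: measurableT_comp => //; exact: measurable_tnth.
by apply/funext => t /=; rewrite tnth_mktuple.
Qed.

(** By Tonelli, the induction hypothesis removes the maps from the inner integral at a fixed first
    coordinate. Invariance under [phi ord0] then applies to that inner integral as a function of the
    first coordinate. *)
Lemma ge0_integral_tuple_map_coord n (phi : 'I_n -> R -> R) (f : n.-tuple R -> \bar R) :
  (forall i, lebesgue_preserving (phi i)) ->
  measurable_fun setT f -> (forall t, 0 <= f t) ->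
  \int[mu n]_t f (tuple_map_coord phi t) = \int[mu n]_t f t.
Proof.
elim: n phi f => [|n IH] phi f hphi mf f0.
  by apply: eq_integral => t _; congr f; apply: eq_from_tnth => -[].
have mtm : measurable_fun setT (tuple_map_coord phi).
  by apply: measurable_tuple_map_coord => i; have [] := hphi i.
rewrite !ge0_integral_tupleS//; last exact: measurableT_comp.
pose psi (i : 'I_n) := phi (lift ord0 i).
have E x t : tuple_map_coord phi (tcons (x, t)) =
    tcons (phi ord0 x, tuple_map_coord psi t).
  apply: eq_from_tnth => i; rewrite tnth_mktuple.
  by have [j ->|->] := unliftP ord0 i; rewrite ?tnth_tcons0// !tnth_tconsS tnth_mktuple.
have mfc x : measurable_fun setT (fun t : n.-tuple R => f (tcons (x, t))).
  apply: measurableT_comp => //.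
  by apply: (measurableT_comp (@measurable_tcons R n)); exact: measurable_fun_pair.
under eq_integral => x _.
  under eq_integral do rewrite E.
  rewrite (IH psi (fun t => f (tcons (phi ord0 x, t))))//; last by move=> i; exact: hphi.
  over.
have [_ hphi0] := hphi ord0.
apply: (hphi0 (fun x => \int[mu n]_t f (tcons (x, t)))) => [|x]; last exact: integral_ge0.
apply: (measurable_fun_fubini_tonelli_F (f \o @tcons R n)); last by move=> x; exact: f0.
by apply: measurableT_comp => //; exact: measurable_tcons.
Qed.

Lemma ge0_integral_prod_tuple n (h : 'I_n -> R -> R) :
  (forall i, measurable_fun setT (h i)) -> (forall i x, (0 <= h i x)%R) ->
  \int[mu n]_t (\prod_(i < n) h i (tnth t i))%:E =
  \prod_(i < n) \int[leb]_x (h i x)%:E.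
Proof.
elim: n h => [|n IH] h mh h0.
  rewrite big_ord0; under eq_integral do rewrite big_ord0.
  by rewrite integral_cst//= diracE mem_set// mule1.
have mp k (g : 'I_k -> R -> R) : (forall i, measurable_fun setT (g i)) ->
    measurable_fun setT (fun t : k.-tuple R => \prod_(i < k) g i (tnth t i))%R.
  move=> mg; apply: measurable_prod => i _.
  by apply: measurableT_comp => //; exact: measurable_tnth.
rewrite ge0_integral_tupleS; last 2 first.
- by apply/measurable_EFinP; exact: mp.
- by move=> t; rewrite lee_fin; apply: prodr_ge0 => i _; exact: h0.
rewrite big_ord_recl -IH//.
under eq_integral => x _.
  under eq_integral => t _.
    rewrite big_ord_recl EFinM tnth_tcons0.
    under eq_bigr do rewrite tnth_tconsS.
    over.
  rewrite ge0_integralZl//; last 3 first.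
  - by apply/measurable_EFinP; apply: (mp _ (fun i => h (lift ord0 i))).
  - by move=> t _; rewrite lee_fin; apply: prodr_ge0 => i _; exact: h0.
  - by rewrite lee_fin; exact: h0.
  over.
rewrite /=.
rewrite ge0_integralZr//.
- by apply/measurable_EFinP; exact: mh.
- by move=> x _; rewrite lee_fin; exact: h0.
- by apply: integral_ge0 => t _; rewrite lee_fin; apply: prodr_ge0 => i _; exact: h0.
Qed.

End LebesgueTuple.

(** * Integration on R^n *)

Section IntegralRn.
Variables (R : realType) (n : nat).
Local Notation V := 'rV[R]_n.
Local Notation mu := (lebesgue_measure_tuple R n).
Implicit Types (f g : V -> R) (t : n.-tuple R).

Definition row_of_tuple t : V := \row_(i < n) tnth t i.

Definition measurable_Rn f := measurable_fun setT (f \o row_of_tuple).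

Definition integrable_Rn f := mu.-integrable setT (EFin \o (f \o row_of_tuple)).

Definition grid_point (k : nat) (z : {ffun 'I_n -> int}) : V :=
  \row_i ((z i)%:~R / k.+1%:R).

Definition grid_index (k : nat) t : {ffun 'I_n -> int} :=
  [ffun i => Num.floor (k.+1%:R * tnth t i)].

Lemma cvg_grid t : grid_point k (grid_index k t) @[k --> \oo] --> row_of_tuple t.
Proof.
apply/cvg_ballP => e e0; near=> k.
have k0 : 0 < k.+1%:R :> R by rewrite ltr0n.
split => // i j; rewrite !mxE ffunE /ball/=.
have /andP[] := floor_itv (k.+1%:R * tnth t j).
set z := Num.floor _; rewrite intrD mulr1z => h1 h2.
have -> : tnth t j - z%:~R / k.+1%:R = (k.+1%:R * tnth t j - z%:~R) / k.+1%:R.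
  by rewrite mulrBl mulrAC mulfV ?mul1r// gt_eqF.
rewrite ger0_norm; last by rewrite divr_ge0 ?subr_ge0// ltW.
apply: (@le_lt_trans _ _ (k.+1%:R^-1)).
  by rewrite ler_pdivrMr// mulVf ?gt_eqF// lerBlDl ltW.
near: k; exact: (near_infty_natSinv_lt (PosNum e0)).
Unshelve. all: by end_near. Qed.

Lemma measurable_grid_index k (z : {ffun 'I_n -> int}) :
  measurable (grid_index k @^-1` [set z]).
Proof.
have -> : grid_index k @^-1` [set z] = \bigcap_(i in [set: 'I_n])
    ((@tnth n R ^~ i) @^-1` `[(z i)%:~R / k.+1%:R, (z i + 1)%:~R / k.+1%:R[%classic).
  have k0 : 0 < k.+1%:R :> R by rewrite ltr0n.
  apply/seteqP; split => t /=.
    move=> /ffunP tz i _ /=; have := tz i; rewrite ffunE => /eqP.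
    by rewrite floor_eq in_itv/= ler_pdivrMr// ltr_pdivlMr// mulrC.
  move=> tz; apply/ffunP => i; rewrite ffunE; apply/eqP; rewrite floor_eq.
  have := tz i I; rewrite /= in_itv/= ler_pdivrMr// ltr_pdivlMr//.
  by rewrite mulrC.
apply: fin_bigcap_measurable => // i _.
rewrite -[X in measurable X]setTI; exact: measurable_tnth.
Qed.

(* [f] is the pointwise limit of its values on the grids of step [1 / k.+1], and
   these approximations take countably many values. *)
Lemma continuous_measurable_Rn f : continuous f -> measurable_Rn f.
Proof.
move=> cf; apply: (@measurable_fun_cvg _ _ _ _
    (fun k t => f (grid_point k (grid_index k t)))); last first.
  move=> t _; exact: (cvg_comp _ _ (@cvg_grid t) (cf (row_of_tuple t))).
move=> k _ Y mY; rewrite setTI.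
rewrite (_ : _ @^-1` Y = \bigcup_(z : {ffun 'I_n -> int})
    (if f (grid_point k z) \in Y then grid_index k @^-1` [set z] else set0)).
  apply: countable_bigcupT_measurable => [|z]; first exact: countableP.
  by case: ifP => _ //; exact: measurable_grid_index.
apply/seteqP; split => t /=.
  by move=> Yt; exists (grid_index k t) => //; rewrite ifT// inE.
by move=> [z _]; case: ifPn => //; rewrite inE => Yz /= ->.
Qed.

Lemma integral_tuple_map_coord (phi : 'I_n -> R -> R) (f : n.-tuple R -> \bar R) :
  (forall i, lebesgue_preserving (phi i)) -> measurable_fun setT f ->
  (\int[mu]_t f (tuple_map_coord phi t) = \int[mu]_t f t)%E.
Proof.
move=> hphi mf; rewrite [LHS]integralE [RHS]integralE; congr (_ - _)%E.
- rewrite -[RHS](ge0_integral_tuple_map_coord hphi); last 2 first.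
  + exact: measurable_funepos.
  + by move=> t; exact: funepos_ge0.
  by apply: eq_integral => t _; rewrite !funeposE.
- rewrite -[RHS](ge0_integral_tuple_map_coord hphi); last 2 first.
  + exact: measurable_funeneg.
  + by move=> t; exact: funeneg_ge0.
  by apply: eq_integral => t _; rewrite !funenegE.
Qed.

Lemma integrable_tuple_map_coord (phi : 'I_n -> R -> R) (f : n.-tuple R -> \bar R) :
  (forall i, lebesgue_preserving (phi i)) -> mu.-integrable setT f ->
  mu.-integrable setT (f \o tuple_map_coord phi).
Proof.
move=> hphi /integrableP[mf foo]; apply/integrableP; split.
  apply: measurableT_comp => //; apply: measurable_tuple_map_coord => i.
  by have [] := hphi i.
rewrite (ge0_integral_tuple_map_coord hphi (f := (abse \o f)%E))//=.
exact: measurableT_comp.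
Qed.

Lemma row_of_tuple_shift (a : V) t :
  row_of_tuple (tuple_map_coord (fun i x => x + a 0 i) t) = row_of_tuple t + a.
Proof. by apply/rowP => i; rewrite !mxE tnth_mktuple. Qed.

Lemma row_of_tuple_opp t :
  row_of_tuple (tuple_map_coord (fun=> -%R) t) = - row_of_tuple t.
Proof. by apply/rowP => i; rewrite !mxE tnth_mktuple. Qed.

Lemma integral_Rn_shift f (a : V) : measurable_Rn f ->
  integral_Rn (fun x => f (x + a)) = integral_Rn f.
Proof.
move=> mf; rewrite /integral_Rn /Rintegral; congr fine.
rewrite -[RHS](integral_tuple_map_coord (phi := fun i x => x + a 0 i)).
- by apply: eq_integral => t _; rewrite -/(row_of_tuple _) -row_of_tuple_shift.
- by move=> i; exact: lebesgue_preserving_shift.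
- exact/measurable_EFinP.
Qed.

Lemma integral_Rn_opp f : measurable_Rn f ->
  integral_Rn (fun x => f (- x)) = integral_Rn f.
Proof.
move=> mf; rewrite /integral_Rn /Rintegral; congr fine.
rewrite -[RHS](integral_tuple_map_coord (phi := fun=> -%R)).
- by apply: eq_integral => t _; rewrite -/(row_of_tuple _) -row_of_tuple_opp.
- by move=> i; exact: lebesgue_preserving_opp.
- exact/measurable_EFinP.
Qed.

Lemma integrable_Rn_shift f (a : V) : integrable_Rn f ->
  integrable_Rn (fun x => f (x + a)).
Proof.
move=> fi; have := integrable_tuple_map_coord
  (fun i => lebesgue_preserving_shift (a 0 i)) fi.
apply: eq_integrable => // t _ /=.
by rewrite -/(tuple_map_coord _ _) row_of_tuple_shift.
Qed.

Lemma integrable_Rn_measurable f : integrable_Rn f -> measurable_Rn f.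
Proof. by move=> /integrableP[/measurable_EFinP]. Qed.

Lemma integrable_RnZ c f : integrable_Rn f -> integrable_Rn (fun x => c * f x).
Proof. by move=> fi; exact: (@integrableZl _ _ _ _ _ measurableT c _ fi). Qed.

Lemma integrable_RnD f g : integrable_Rn f -> integrable_Rn g ->
  integrable_Rn (fun x => f x + g x).
Proof. by move=> fi gi; exact: (integrableD measurableT fi gi). Qed.

Lemma integrable_RnN f : integrable_Rn f -> integrable_Rn (fun x => - f x).
Proof.
by move=> /(integrable_RnZ (-1)); apply: eq_integrable => // t _ /=; rewrite mulN1r.
Qed.

Lemma integrable_RnB f g : integrable_Rn f -> integrable_Rn g ->
  integrable_Rn (fun x => f x - g x).
Proof. by move=> fi gi; apply: integrable_RnD => //; exact: integrable_RnN. Qed.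

Lemma integrable_Rn_sum (I : Type) (s : seq I) (F : I -> V -> R) :
  (forall i, integrable_Rn (F i)) -> integrable_Rn (fun x => \sum_(i <- s) F i x).
Proof.
move=> hF; have := integrable_sum measurableT s (P := xpredT) (fun i _ => hF i).
by apply: eq_integrable => // t _ /=; rewrite sumEFin.
Qed.

Lemma integrable_Rn_norm f : integrable_Rn f -> integrable_Rn (fun x => `|f x|).
Proof. by move=> fi; exact: (integrable_norm fi). Qed.

Lemma integrable_Rn_le f g : measurable_Rn f -> (forall x, `|f x| <= g x) ->
  integrable_Rn g -> integrable_Rn f.
Proof.
move=> mf fg gi; apply: le_integrable gi => //; first exact/measurable_EFinP.
by move=> t _ /=; rewrite lee_fin (le_trans (fg _))// ler_norm.
Qed.

Lemma eq_integral_Rn f g : (forall x, f x = g x) -> integral_Rn f = integral_Rn g.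
Proof. by move=> fg; congr integral_Rn; apply/funext. Qed.

Lemma integral_RnZ c f : integrable_Rn f ->
  integral_Rn (fun x => c * f x) = c * integral_Rn f.
Proof. by move=> fi; rewrite /integral_Rn RintegralZl. Qed.

Lemma integral_RnD f g : integrable_Rn f -> integrable_Rn g ->
  integral_Rn (fun x => f x + g x) = integral_Rn f + integral_Rn g.
Proof. by move=> fi gi; rewrite /integral_Rn RintegralD. Qed.

Lemma integral_RnB f g : integrable_Rn f -> integrable_Rn g ->
  integral_Rn (fun x => f x - g x) = integral_Rn f - integral_Rn g.
Proof. by move=> fi gi; rewrite /integral_Rn RintegralB. Qed.

Lemma integral_Rn_sum (I : Type) (s : seq I) (F : I -> V -> R) :
  (forall i, integrable_Rn (F i)) ->
  integral_Rn (fun x => \sum_(i <- s) F i x) = \sum_(i <- s) integral_Rn (F i).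
Proof.
move=> hF; elim: s => [|i s IH].
  rewrite big_nil (@eq_integral_Rn _ (fun=> 0 * 0)) => [|x]; last first.
    by rewrite big_nil mul0r.
  rewrite /integral_Rn /Rintegral; under eq_integral do rewrite mul0r.
  by rewrite integral0.
rewrite big_cons -IH -integral_RnD//; last exact: integrable_Rn_sum.
by apply: eq_integral_Rn => x; rewrite big_cons.
Qed.

Lemma ler_integral_Rn f g : integrable_Rn f -> integrable_Rn g ->
  (forall x, f x <= g x) -> integral_Rn f <= integral_Rn g.
Proof. by move=> fi gi fg; apply: le_Rintegral. Qed.

Lemma ler_norm_integral_Rn f g : measurable_Rn f -> integrable_Rn g ->
  (forall x, `|f x| <= g x) -> `|integral_Rn f| <= integral_Rn g.
Proof.
move=> mf gi fg; have fi := integrable_Rn_le mf fg gi.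
apply: le_trans (le_normr_Rintegral _ fi) _ => //.
exact: (ler_integral_Rn (integrable_Rn_norm fi) gi).
Qed.

Lemma measurable_prod_Rn (h : 'I_n -> R -> R) :
  (forall i, measurable_fun setT (h i)) ->
  measurable_Rn (fun x => \prod_(i < n) h i (x 0 i)).
Proof.
move=> mh; rewrite /measurable_Rn.
have -> : (fun x : V => \prod_(i < n) h i (x 0 i)) \o row_of_tuple =
    fun t => \prod_(i < n) h i (tnth t i).
  by apply/funext => t /=; apply: eq_bigr => i _; rewrite mxE.
apply: measurable_prod => i _.
by apply: measurableT_comp => //; exact: measurable_tnth.
Qed.

Lemma integral_prod_Rn (h : 'I_n -> R -> R) (c : 'I_n -> R) :
  (forall i, measurable_fun setT (h i)) -> (forall i x, 0 <= h i x) ->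
  (forall i, \int[lebesgue_measure]_x (h i x)%:E = (c i)%:E)%E ->
  integrable_Rn (fun x => \prod_(i < n) h i (x 0 i)) /\
  integral_Rn (fun x => \prod_(i < n) h i (x 0 i)) = \prod_(i < n) c i.
Proof.
move=> mh h0 hc.
have E : (\int[mu]_t (\prod_(i < n) h i (row_of_tuple t 0 i))%:E =
    (\prod_(i < n) c i)%:E)%E.
  under eq_integral => t _ do under eq_bigr do rewrite mxE.
  rewrite ge0_integral_prod_tuple//.
  by rewrite -prodEFin; apply: eq_bigr => i _; exact: hc.
split; last by rewrite /integral_Rn /Rintegral E.
apply/integrableP; split; first by apply/measurable_EFinP; exact: (measurable_prod_Rn mh).
rewrite (eq_integral (fun t => (\prod_(i < n) h i (row_of_tuple t 0 i))%:E)).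
  by rewrite E ltry.
by move=> t _ /=; rewrite ger0_norm// prodr_ge0.
Qed.

End IntegralRn.

(** * Derivatives from quadratic estimates *)

Section DirectionalDerivative.
Variables (R : realType) (V : normedModType R).
Implicit Types (f : V -> R) (x v : V).

(** A remainder of order [h ^+ 2] leaves an error of at most [C * |h|] in the difference quotient.
    Such a bound can be integrated over a parameter, which is how derivatives pass under the
    integral sign. The restriction to [|h| <= 1] leaves room for bounds such as [weight_shift],
    valid only for small translations. *)
Lemma is_derive_quadratic f x v (d C : R) :
  (forall h : R, `|h| <= 1 -> `|f (h *: v + x) - f x - h * d| <= C * h ^+ 2) ->
  is_derive x v f d.
Proof.
move=> H.
suff E : (fun h : R => h^-1 *: ((f \o shift x) (h *: v) - f x)) @ 0^' --> d.
  by apply: DeriveDef; [apply/cvg_ex; exists d|exact: cvg_lim E].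
have C0 : 0 <= C.
  by have := H 1; rewrite normr1 expr1n mulr1 => /(_ (lexx _)); exact: le_trans.
apply/cvgrPdist_le => e e0.
have eC : 0 < Num.min 1 (e / (C + 1)) by rewrite lt_min ltr01 divr_gt0// ltr_wpDl.
near=> h.
have h0 : h != 0 by near: h; exact: nbhs_dnbhs_neq.
rewrite /=.
have : `|h| < Num.min 1 (e / (C + 1)).
  near: h. exact: dnbhs0_lt.
rewrite lt_min => /andP[/ltW h1 he].
have hn : 0 < `|h| by rewrite normr_gt0.
have -> : d - h^-1 *: (f (h *: v + x) - f x) =
    - (h^-1 * (f (h *: v + x) - f x - h * d)).
  by rewrite [in RHS]mulrBr mulKf// opprB.
rewrite normrN normrM normfV mulrC ler_pdivrMr//.
apply: le_trans (H _ h1) _.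
rewrite -[h ^+ 2]real_normK ?num_real// expr2 mulrA ler_pM2r//.
have : C * `|h| <= (C + 1) * (e / (C + 1)).
  by apply: ler_pM => //; [rewrite lerDl|exact: ltW].
by rewrite [leRHS]mulrC divfK// gt_eqF// ltr_wpDl.
Unshelve. all: by end_near. Qed.

(** Restriction to a line gives access to the mean value theorem and the chain rule of one variable;
    [is_derive_of_line] goes back. *)
Lemma is_derive_line f x v (s d : R) : is_derive (x + s *: v) v f d ->
  is_derive s 1 (fun r : R => f (x + r *: v)) d.
Proof.
move=> [df Df].
suff E : (fun h : R => h^-1 *: (((fun r : R => f (x + r *: v)) \o shift s) (h *: 1)
    - f (x + s *: v))) @ 0^' --> d.
  by apply: DeriveDef; [apply/cvg_ex; exists d|exact: cvg_lim E].
rewrite -Df; move: df; rewrite /derivable /derive => df.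
rewrite (_ : (fun h : R => _) = (fun h : R => h^-1 *:
  ((f \o shift (x + s *: v)) (h *: v) - f (x + s *: v))) :> (R -> R))//.
apply/funext => h /=; congr (_ *: (f _ - _)).
by rewrite addrCA scalerDl -scalerA scale1r.
Qed.

Lemma is_derive_of_line f x v (d : R) :
  is_derive (0 : R) 1 (fun r : R => f (x + r *: v)) d -> is_derive x v f d.
Proof.
move=> [df Df].
suff E : (fun h : R => h^-1 *: ((f \o shift x) (h *: v) - f x)) @ 0^' --> d.
  by apply: DeriveDef; [apply/cvg_ex; exists d|exact: cvg_lim E].
rewrite -Df; move: df; rewrite /derivable /derive => df.
rewrite (_ : (fun h : R => _) = (fun h : R => h^-1 *:
  (((fun r : R => f (x + r *: v)) \o shift 0) (h *: 1) - f (x + 0 *: v))) :> (R -> R))//.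
apply/funext => h /=; congr (_ *: (f _ - f _)).
  by rewrite addr0 addrC /GRing.scale/= mulr1.
by rewrite scale0r addr0.
Qed.

End DirectionalDerivative.

Section Taylor.
Variable R : realType.
Implicit Types phi dphi d2phi : R -> R.

Lemma mvt_origin phi dphi (h : R) : (forall s : R, is_derive s 1 phi (dphi s)) ->
  exists c, `|c| <= `|h| /\ phi h - phi 0 = h * dphi c.
Proof.
move=> H; have cphi A : {within A, continuous phi}.
  apply: continuous_subspaceT => s; apply: differentiable_continuous.
  by apply/derivable1_diffP; have [] := H s.
have [h0|h0] := leP 0 h.
  have [c] := MVT_segment h0 (fun s _ => H s) (@cphi _).
  rewrite in_itv/= => /andP[c0 ch] E; exists c; split.
    by rewrite !ger0_norm.
  by rewrite E subr0 mulrC.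
have [c] := MVT_segment (ltW h0) (fun s _ => H s) (@cphi _).
rewrite in_itv/= => /andP[hc c0] E; exists c; split.
  by rewrite !ler0_norm ?lerN2// ltW.
by rewrite -[LHS]opprB E sub0r mulrN opprK mulrC.
Qed.

(** Two uses of the mean value theorem give the remainder [h * c * d2phi e] with
    [|e| <= |c| <= |h|]; hence the constant [M] instead of the sharp [M / 2]. *)
Lemma taylor_quadratic phi dphi d2phi (M h : R) :
  (forall s : R, is_derive s 1 phi (dphi s)) ->
  (forall s : R, is_derive s 1 dphi (d2phi s)) ->
  (forall s : R, `|s| <= `|h| -> `|d2phi s| <= M) ->
  `|phi h - phi 0 - h * dphi 0| <= M * h ^+ 2.
Proof.
move=> H1 H2 HM.
have [c [ch E]] := mvt_origin h H1.
have [e [ec E2]] := mvt_origin c H2.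
rewrite E -mulrBr E2 !normrM mulrA mulrC.
rewrite -[h ^+ 2]real_normK ?num_real// expr2.
apply: ler_pM; rewrite ?mulr_ge0//; first exact: HM (le_trans ec ch).
by rewrite ler_wpM2l.
Qed.

End Taylor.

(** * Schwartz functions *)

Section RapidDecrease.
Variables (R : realType) (n : nat).
Local Notation V := 'rV[R]_n.
Implicit Types (f g : V -> R) (x v : V).

Definition monomial (a : 'I_n -> nat) x : R := \prod_(i < n) x 0 i ^+ a i.

(** The order-zero part of [rapidly_decreasing]; derivatives are handled by applying it to each
    iterated partial derivative. *)
Definition rapid f := forall a, exists C, forall x, `|monomial a x * f x| <= C.

Lemma rapidD f g : rapid f -> rapid g -> rapid (fun x => f x + g x).
Proof.
move=> rf rg a; have [C fC] := rf a; have [D gD] := rg a.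
by exists (C + D) => x; rewrite mulrDr (le_trans (ler_normD _ _))// lerD.
Qed.

Lemma rapidZ c f : rapid f -> rapid (fun x => c * f x).
Proof.
move=> rf a; have [C fC] := rf a.
by exists (`|c| * C) => x; rewrite mulrCA normrM ler_wpM2l.
Qed.

Lemma rapid_coord i f : rapid f -> rapid (fun x => x 0 i * f x).
Proof.
move=> rf a; have [C fC] := rf (fun j => a j + (j == i))%N.
exists C => x; rewrite mulrA (_ : monomial a x * x 0 i =
  monomial (fun j => a j + (j == i))%N x)//.
rewrite /monomial [RHS](bigD1 i)//= eqxx addn1 exprSr [LHS](_ : _ =
  (x 0 i ^+ a i * \prod_(j < n | j != i) x 0 j ^+ a j) * x 0 i).
  rewrite mulrAC; congr (_ * _).
  by apply: eq_bigr => j /negPf ->; rewrite addn0.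
by rewrite (bigD1 i).
Qed.

(** A product of unnormalised Cauchy densities, serving as a common integrable majorant: its
    integral factors by Tonelli. *)
Definition weight x : R := \prod_(i < n) (1 + x 0 i ^+ 2)^-1.

Lemma weight_gt0 x : 0 < weight x.
Proof. by apply: prodr_gt0 => i _; rewrite invr_gt0 ltr_wpDr// sqr_ge0. Qed.

(** Multiplication by [1 + x 0 i ^+ 2] preserves rapid decrease, being the sum of the identity and
    two multiplications by a coordinate. Doing this once per coordinate and using the bound for the
    trivial monomial gives the claim. *)
Lemma rapid_weight f : rapid f -> exists C, forall x, `|f x| <= C * weight x.
Proof.
move=> rf.
have H (s : seq 'I_n) : rapid (fun x => (\prod_(i <- s) (1 + x 0 i ^+ 2)) * f x).
  elim: s => [|i s IH] a.
    have [C hC] := rf a; exists C => x; rewrite big_nil mul1r; exact: hC.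
  have [C hC] := rapidD IH (rapid_coord i (rapid_coord i IH)) a; exists C => x.
  apply: le_trans (hC x); rewrite big_cons le_eqVlt; apply/orP; left.
  by apply/eqP; congr (`|_ * _|); ring.
have [C hC] := H (index_enum _) (fun=> 0%N); exists C => x.
have := hC x; rewrite /monomial big1 ?mul1r => [|i _]; last by rewrite expr0.
have p0 : 0 < \prod_(i < n) (1 + x 0 i ^+ 2).
  by apply: prodr_gt0 => i _; rewrite ltr_wpDr// sqr_ge0.
by rewrite normrM gtr0_norm// /weight prodfV ler_pdivlMr// mulrC.
Qed.

Lemma integral_oneDsqr :
  (\int[@lebesgue_measure R]_x ((1 + x ^+ 2)^-1)%:E = pi%:E)%E.
Proof.
rewrite (@ge0_symfun_integralT _ (fun r => (1 + r ^+ 2)^-1)).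
- have := integral0y_oneDsqr R; rewrite set_itvcy => ->.
  by rewrite -EFinM mulrC divfK.
- by move=> x; rewrite invr_ge0 addr_ge0// sqr_ge0.
- exact: continuous_oneDsqrV.
- by move=> x /=; rewrite sqrrN.
Qed.

Lemma integrable_weight : integrable_Rn weight.
Proof.
have [] // := @integral_prod_Rn R n (fun _ r => (1 + r ^+ 2)^-1) (fun=> pi).
- by move=> i; apply: continuous_measurable_fun; exact: continuous_oneDsqrV.
- by move=> i x; rewrite invr_ge0 addr_ge0// sqr_ge0.
- by move=> i; exact: integral_oneDsqr.
Qed.

Lemma rapid_integrable f : measurable_Rn f -> rapid f -> integrable_Rn f.
Proof.
move=> mf /rapid_weight[C hC]; apply: integrable_Rn_le mf hC _.
exact: integrable_RnZ integrable_weight.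
Qed.

End RapidDecrease.

Section Schwartz.
Variables (R : realType) (n : nat).
Local Notation V := 'rV[R]_n.
Implicit Types (f g : V -> R) (x v : V).

(* To show that all the iterated derivatives of a function are rapidly decreasing,
   it suffices to put it in a class of such functions stable under [partial]. *)
Lemma schwartz_coind (K : (V -> R) -> Prop) :
  (forall f, K f -> continuous f) ->
  (forall f i x, K f -> derivable f x (delta_mx 0 i)) ->
  (forall f i, K f -> K (partial i f)) ->
  (forall f, K f -> rapid f) ->
  forall f, K f -> f \in @schwartz R n.
Proof.
move=> Kc Kd Kp Kr f Kf.
have H s : K (iter_partial s f) by elim: s => //= i s IH; exact: Kp.
rewrite inE; split=> [s|a s]; first by split=> [|i x]; [exact: Kc|exact: Kd].
exact: Kr.
Qed.

Lemma schwartz_continuous f : f \in @schwartz R n -> continuous f.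
Proof. by rewrite inE => -[sf _]; have [] := sf [::]. Qed.

Lemma schwartz_derivable f i x : f \in @schwartz R n -> derivable f x (delta_mx 0 i).
Proof. by rewrite inE => -[sf _]; have [_] := sf [::]; exact. Qed.

Lemma schwartz_rapid f : f \in @schwartz R n -> rapid f.
Proof. by rewrite inE => -[_ rf] a; exact: (rf a [::]). Qed.

Lemma schwartz_partial i f : f \in @schwartz R n -> partial i f \in @schwartz R n.
Proof.
have E s : iter_partial s (partial i f) = iter_partial (rcons s i) f.
  by rewrite /iter_partial foldr_rcons.
by rewrite !inE => -[sf rf]; split=> [s|a s]; rewrite E; [exact: sf|exact: rf].
Qed.

Lemma is_derive_partial f i x : f \in @schwartz R n ->
  is_derive x (delta_mx 0 i) f (partial i f x).
Proof. by move=> fS; apply: DeriveDef => //; exact: schwartz_derivable. Qed.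

Lemma is_derive_coord i x v : is_derive x v (fun y : V => y 0 i) (v 0 i).
Proof.
apply: (@is_derive_quadratic _ _ _ _ _ _ 0) => h _.
by rewrite !mxE mul0r addrK subrr normr0.
Qed.

Lemma schwartzD f g : f \in @schwartz R n -> g \in @schwartz R n ->
  (fun x => f x + g x) \in @schwartz R n.
Proof. by move=> fS gS; exact: (rpredD fS gS). Qed.

Lemma schwartzZ c f : f \in @schwartz R n -> (fun x => c * f x) \in @schwartz R n.
Proof. by move=> fS; exact: (@rpredZ _ _ (@schwartz R n) c f fS). Qed.

Lemma schwartz_sum (I : Type) (s : seq I) (F : I -> V -> R) :
  (forall i, F i \in @schwartz R n) -> (fun x => \sum_(i <- s) F i x) \in @schwartz R n.
Proof.
move=> hF; elim: s => [|i s IH].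
  rewrite (_ : (fun=> _) = 0) ?rpred0//.
  by apply/funext => x; rewrite big_nil.
rewrite (_ : (fun=> _) = fun x => F i x + \sum_(j <- s) F j x); first exact: schwartzD.
by apply/funext => x; rewrite big_cons.
Qed.

Lemma is_derive_coordM f i j x : f \in @schwartz R n ->
  is_derive x (delta_mx 0 j) (fun x => x 0 i * f x)
    (x 0 i * partial j f x + (i == j)%:R * f x).
Proof.
move=> fS; have d1 := is_derive_coord i x (delta_mx 0 j).
have := is_deriveM d1 (is_derive_partial j x fS).
by rewrite mxE eqxx /= /GRing.scale/= [f x * _]mulrC.
Qed.

Lemma schwartz_coord i f : f \in @schwartz R n ->
  (fun x => x 0 i * f x) \in @schwartz R n.
Proof.
move=> fS.
(* The summand [f2] makes the class stable: the product rule leaves a term [(i == j)%:R * f1]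
   without the factor [x 0 i]. *)
pose K (h : V -> R) := exists f1 f2, [/\ f1 \in @schwartz R n, f2 \in @schwartz R n
  & h = fun x => x 0 i * f1 x + f2 x].
have dK (f1 f2 : V -> R) j x : f1 \in @schwartz R n -> f2 \in @schwartz R n ->
    is_derive x (delta_mx 0 j) (fun x => x 0 i * f1 x + f2 x)
      (x 0 i * partial j f1 x + ((i == j)%:R * f1 x + partial j f2 x)).
  move=> f1S f2S.
  have := is_deriveD (is_derive_coordM i j x f1S) (is_derive_partial j x f2S).
  by rewrite addrA.
apply: (schwartz_coind (K := K)).
- move=> _ [f1 [f2 [f1S f2S ->]]] x.
  have c1 := @coord_continuous R 1 n 0 i x.
  exact: (cvgD (cvgM c1 (schwartz_continuous f1S (x := x))) (schwartz_continuous f2S (x := x))).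
- by move=> _ j x [f1 [f2 [f1S f2S ->]]]; have [] := dK f1 f2 j x f1S f2S.
- move=> _ j [f1 [f2 [f1S f2S ->]]].
  exists (partial j f1), (fun x => (i == j)%:R * f1 x + partial j f2 x); split.
  + exact: schwartz_partial.
  + by apply: schwartzD; [exact: schwartzZ|exact: schwartz_partial].
  + by apply/funext => x; have [_] := dK f1 f2 j x f1S f2S.
- move=> _ [f1 [f2 [f1S f2S ->]]].
  by apply: rapidD; [apply: rapid_coord|]; exact: schwartz_rapid.
- exists f, 0; split=> //; first exact: rpred0.
  by apply/funext => x; rewrite addr0.
Qed.

Lemma schwartz_dotv v f : f \in @schwartz R n ->
  (fun x => dotv v x * f x) \in @schwartz R n.
Proof.
move=> fS.
rewrite (_ : (fun x => _) = fun x => \sum_(i < n) v 0 i * (x 0 i * f x)).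
  by apply: schwartz_sum => i; apply: schwartzZ; exact: schwartz_coord.
apply/funext => x; rewrite /dotv mulr_suml.
by apply: eq_bigr => i _; rewrite mulrA.
Qed.

Lemma schwartz_integrable f : f \in @schwartz R n -> integrable_Rn f.
Proof.
move=> fS; apply: rapid_integrable; last exact: schwartz_rapid.
by apply: continuous_measurable_Rn; exact: schwartz_continuous.
Qed.

End Schwartz.

(** * The Hartley transform *)

Section HartleyKernel.
Variable R : realType.
Implicit Types s t h : R.

(** Hartley's kernel [cos + sin] taken at [- t], with the sign of [fourier_sin]. Its derivative is
    again a reflected copy of itself, up to sign. *)
Definition cms t : R := cos t - sin t.

Lemma ler_norm_cms t : `|cms t| <= 2.
Proof.
rewrite (le_trans (ler_normB _ _))// (_ : 2 = 1 + 1 :> R)//.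
apply: lerD; rewrite ler_norml; last by rewrite sin_geN1 sin_le1.
by rewrite cos_geN1 cos_le1.
Qed.

Lemma cmsN t : cms (- t) = cos t + sin t.
Proof. by rewrite /cms cosN sinN opprK. Qed.

(** With [s = dotv y x], this addition formula turns a translation of the integration variable into
    a combination of [hartley f y] and [hartley f (- y)]. *)
Lemma cms_sub s t : cms (s - t) = cms s * cos t + cms (- s) * sin t.
Proof. by rewrite cmsN /cms cosB sinB; ring. Qed.

Lemma is_derive_cms t : is_derive t 1 cms (- cms (- t)).
Proof.
have := is_deriveB (is_derive_cos t) (is_derive_sin t).
by rewrite cmsN opprD [- sin t - _]addrC.
Qed.

Lemma is_derive_cmsN t : is_derive t 1 (fun r => - cms (- r)) (- cms t).
Proof.
have := is_deriveN (is_deriveD (is_derive_cos t) (is_derive_sin t)).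
rewrite (_ : (fun r => - cms (- r)) = - (cos + sin : R -> R)); last first.
  by apply/funext => r; rewrite cmsN.
by rewrite /cms [cos t - _]addrC.
Qed.

(** The second derivative of [cms] is [- cms], of size at most 2. The bound is uniform in [s], so
    that [s = dotv y x] can vary with the integration variable. *)
Lemma ler_norm_cms_taylor s h :
  `|cms (s + h) - cms s + h * cms (- s)| <= 2 * h ^+ 2.
Proof.
have d1 (r : R) : is_derive r 1 (fun r : R => cms (s + r * 1)) (- cms (- (s + r * 1))).
  exact: (@is_derive_line _ R^o cms s 1 r _ (is_derive_cms _)).
have d2 (r : R) : is_derive r 1 (fun r : R => - cms (- (s + r * 1))) (- cms (s + r * 1)).
  exact: (@is_derive_line _ R^o (fun r => - cms (- r)) s 1 r _ (is_derive_cmsN _)).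
have /= := @taylor_quadratic _ _ _ _ 2 h d1 d2.
rewrite !mulr1 addr0 mulrN opprK; apply => r _.
by rewrite normrN ler_norm_cms.
Qed.

Lemma ler_norm_cms_sub s t : `|cms t - cms s| <= 2 * `|t - s|.
Proof.
have d1 (r : R) : is_derive r 1 (fun r : R => cms (s + r * 1)) (- cms (- (s + r * 1))).
  exact: (@is_derive_line _ R^o cms s 1 r _ (is_derive_cms _)).
have [c [_]] := mvt_origin (t - s) d1.
rewrite !mulr1 addr0 [s + _]addrC subrK => ->.
by rewrite normrM normrN mulrC ler_wpM2r// ler_norm_cms.
Qed.

Lemma continuous_cms : continuous cms.
Proof. by move=> t; apply: cvgB; [exact: continuous_cos|exact: continuous_sin]. Qed.

End HartleyKernel.

(** * Linearity and differentiation rules of the Hartley transform *)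

Section Hartley.
Variables (R : realType) (n : nat).
Local Notation V := 'rV[R]_n.
Local Notation S := (@schwartz R n).
Implicit Types (f g : V -> R) (x y v : V).

Lemma dotvC x y : dotv x y = dotv y x.
Proof. by apply: eq_bigr => i _; rewrite mulrC. Qed.

Lemma dotv_lin h v y x : dotv (h *: v + y) x = h * dotv v x + dotv y x.
Proof.
rewrite /dotv mulr_sumr -big_split; apply: eq_bigr => i _ /=.
by rewrite !mxE mulrDl mulrA.
Qed.

Lemma dotvN x y : dotv (- x) y = - dotv x y.
Proof. by rewrite /dotv -sumrN; apply: eq_bigr => i _; rewrite mxE mulNr. Qed.

Lemma dotv_delta i x : dotv (delta_mx 0 i) x = x 0 i.
Proof.
rewrite /dotv (bigD1 i)//= mxE !eqxx mul1r big1 ?addr0// => j /negPf ji.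
by rewrite mxE ji andbF mul0r.
Qed.

Lemma measurable_Rn_dotv y : measurable_Rn (dotv y).
Proof.
rewrite /measurable_Rn (_ : _ \o _ = fun t => \sum_(i < n) y 0 i * tnth t i).
  apply: measurable_sum => i; apply: measurable_funM => //.
  exact: measurable_tnth.
by apply/funext => t /=; apply: eq_bigr => i _; rewrite mxE.
Qed.

Lemma measurable_RnM f g : measurable_Rn f -> measurable_Rn g ->
  measurable_Rn (fun x => f x * g x).
Proof. by move=> mf mg; exact: measurable_funM. Qed.

Lemma measurable_Rn_cms y : measurable_Rn (fun x => cms (dotv y x)).
Proof.
apply: (measurableT_comp (f := @cms R)); last exact: measurable_Rn_dotv.
by apply: continuous_measurable_fun; exact: continuous_cms.
Qed.

Lemma schwartz_measurable f : f \in S -> measurable_Rn f.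
Proof. by move=> /schwartz_continuous; exact: continuous_measurable_Rn. Qed.

Lemma integrable_Rn_cms f y : integrable_Rn f ->
  integrable_Rn (fun x => f x * cms (dotv y x)).
Proof.
move=> fi; apply: (integrable_Rn_le (g := fun x => 2 * `|f x|)).
- by apply: measurable_RnM; [exact: integrable_Rn_measurable|exact: measurable_Rn_cms].
- by move=> x; rewrite normrM mulrC ler_wpM2r// ler_norm_cms.
- by apply: integrable_RnZ; exact: integrable_Rn_norm.
Qed.

Definition hartley f y : R := integral_Rn (fun x => f x * cms (dotv y x)).

Lemma hartleyN f y : measurable_Rn f ->
  hartley f (- y) = hartley (fun x => f (- x)) y.
Proof.
move=> mf; rewrite /hartley -integral_Rn_opp.
  by apply: eq_integral_Rn => x; rewrite dotvN dotvC dotvN opprK dotvC.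
by apply: measurable_RnM => //; exact: measurable_Rn_cms.
Qed.

Lemma hartleyD f g y : integrable_Rn f -> integrable_Rn g ->
  hartley (fun x => f x + g x) y = hartley f y + hartley g y.
Proof.
move=> fi gi; rewrite /hartley -integral_RnD; try exact: integrable_Rn_cms.
by apply: eq_integral_Rn => x; rewrite mulrDl.
Qed.

Lemma hartleyZ c f y : integrable_Rn f ->
  hartley (fun x => c * f x) y = c * hartley f y.
Proof.
move=> fi; rewrite /hartley -integral_RnZ; last exact: integrable_Rn_cms.
by apply: eq_integral_Rn => x; rewrite mulrA.
Qed.

Lemma hartley_sum (I : Type) (s : seq I) (F : I -> V -> R) y :
  (forall i, integrable_Rn (F i)) ->
  hartley (fun x => \sum_(i <- s) F i x) y = \sum_(i <- s) hartley (F i) y.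
Proof.
move=> hF; rewrite /hartley -integral_Rn_sum => [|i]; last exact: integrable_Rn_cms.
by apply: eq_integral_Rn => x; rewrite mulr_suml.
Qed.

(** The Taylor remainder of the kernel is at most [2 * (h * dotv v x) ^+ 2], and [f] stays
    integrable after two multiplications by [dotv v x]. The direction is arbitrary because
    [hartley_gauss] differentiates along [y] itself. *)
Lemma is_derive_hartley f y v : f \in S ->
  is_derive y v (hartley f) (- hartley (fun x => dotv v x * f x) (- y)).
Proof.
move=> fS.
have fi := schwartz_integrable fS.
have gS := schwartz_dotv v fS; have gi := schwartz_integrable gS.
have g2i := schwartz_integrable (schwartz_dotv v gS).
pose G x := dotv v x * (dotv v x * f x).
apply: (@is_derive_quadratic _ _ _ _ _ _ (integral_Rn (fun x => 2 * `|G x|))) => h _.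
rewrite mulrN opprK /hartley -integral_RnB; try exact: integrable_Rn_cms.
rewrite -integral_RnZ; last exact: integrable_Rn_cms.
have i1 : integrable_Rn (fun x => f x * cms (dotv (h *: v + y) x) - f x * cms (dotv y x)).
  by apply: integrable_RnB; exact: integrable_Rn_cms.
have i2 : integrable_Rn (fun x => h * (dotv v x * f x * cms (dotv (- y) x))).
  by apply: integrable_RnZ; exact: integrable_Rn_cms.
have i3 : integrable_Rn (fun x => 2 * `|G x|).
  by apply: integrable_RnZ; exact: integrable_Rn_norm.
rewrite -integral_RnD// mulrC -integral_RnZ//.
apply: ler_norm_integral_Rn; [|exact: integrable_RnZ|] => [|x].
  by apply: integrable_Rn_measurable; exact: integrable_RnD.
have -> : f x * cms (dotv (h *: v + y) x) - f x * cms (dotv y x) +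
    h * (dotv v x * f x * cms (dotv (- y) x)) =
  f x * (cms (dotv y x + h * dotv v x) - cms (dotv y x) +
    (h * dotv v x) * cms (- dotv y x)).
  by rewrite dotv_lin dotvN [h * _ + _]addrC; ring.
rewrite normrM mulrC (le_trans (ler_wpM2r _ (ler_norm_cms_taylor _ _)))//.
rewrite /G !normrM exprMn -[dotv v x ^+ 2]real_normK ?num_real//.
by rewrite le_eqVlt; apply/orP; left; apply/eqP; ring.
Qed.

(** Taylor's formula evaluates a second derivative at translated points; this makes the resulting
    majorant independent of the translation. *)
Lemma weight_shift x s i : `|s| <= 1 ->
  weight (x + s *: delta_mx 0 i) <= 3 * weight x.
Proof.
move=> s1; rewrite /weight (bigD1 i)//= [X in _ <= 3 * X](bigD1 i)//= mulrA.
rewrite (eq_bigr (fun j => (1 + x 0 j ^+ 2)^-1)); last first.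
  by move=> j /negPf ji; rewrite !mxE ji andbF mulr0 addr0.
apply: ler_wpM2r.
  by apply: prodr_ge0 => j _; rewrite invr_ge0 addr_ge0// sqr_ge0.
rewrite !mxE !eqxx mulr1.
have p1 : 0 < 1 + x 0 i ^+ 2 by rewrite ltr_wpDr// sqr_ge0.
have p2 : 0 < 1 + (x 0 i + s) ^+ 2 by rewrite ltr_wpDr// sqr_ge0.
rewrite ler_pdivlMr// mulrC ler_pdivrMr//.
(* With [u = x 0 i], the difference [3 * (1 + (u + s) ^+ 2) - (1 + u ^+ 2)] is half of
   [(2 * u + 3 * s) ^+ 2] plus [2 - 3 / 2 * s ^+ 2]. *)
have : s ^+ 2 <= 1 by rewrite -[s ^+ 2]real_normK ?num_real// exprn_ile1.
have := sqr_ge0 (x 0 i + 2 * s).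
have := sqr_ge0 (2 * x 0 i + 3 * s).
nra.
Qed.

Lemma hartley_partial f i y : f \in S ->
  hartley (partial i f) y = y 0 i * hartley f (- y).
Proof.
move=> fS; set e : V := delta_mx 0 i.
have fi := schwartz_integrable fS.
have pS := schwartz_partial i fS; have pi := schwartz_integrable pS.
pose F (h : R) := integral_Rn (fun x => f (x + h *: e) * cms (dotv y x)).
have FE h : F h = hartley f y * cos (h * y 0 i) + hartley f (- y) * sin (h * y 0 i).
  rewrite /F.
  rewrite (@eq_integral_Rn _ _ _ (fun x => (fun z => f z * cms (dotv y (z - h *: e)))
    (x + h *: e))); last by move=> x; rewrite addrK.
  have H z : f z * cms (dotv y (z - h *: e)) =
      cos (h * y 0 i) * (f z * cms (dotv y z)) + sin (h * y 0 i) * (f z * cms (dotv (- y) z)).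
    have -> : dotv y (z - h *: e) = dotv y z - h * y 0 i.
      rewrite dotvC addrC -scaleNr dotv_lin dotv_delta mulNr addrC.
      by rewrite dotvC.
    by rewrite cms_sub dotvN; ring.
  rewrite (@integral_Rn_shift _ _ (fun z => f z * cms (dotv y (z - h *: e)))).
    rewrite (eq_integral_Rn H) integral_RnD; try exact/integrable_RnZ/integrable_Rn_cms.
    rewrite !integral_RnZ; try exact: integrable_Rn_cms.
    by rewrite /hartley mulrC [X in _ + X]mulrC.
  rewrite (funext H); apply: integrable_Rn_measurable; apply: integrable_RnD;
    exact/integrable_RnZ/integrable_Rn_cms.
(* [F] is differentiated at [0] twice: by [FE], moving the translation to the
   kernel, and under the integral sign. *)
have d1 : is_derive (0 : R) 1 F (y 0 i * hartley f (- y)).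
  rewrite (funext FE).
  have dl : is_derive (0 : R) 1 (fun h : R => h * y 0 i) (y 0 i).
    apply: (@is_derive_quadratic _ _ _ _ _ _ 0) => h _.
    by rewrite /GRing.scale/= mulr1 addr0 mul0r mul0r subr0 subrr normr0.
  have dc := @is_derive1_comp _ cos (fun h => h * y 0 i) 0 _ _ (is_derive_cos _) dl.
  have ds := @is_derive1_comp _ sin (fun h => h * y 0 i) 0 _ _ (is_derive_sin _) dl.
  have := is_deriveD (is_deriveZ (hartley f y) dc) (is_deriveZ (hartley f (- y)) ds).
  by rewrite /GRing.scale/= mul0r sin0 cos0 oppr0 mul0r mulr0 add0r mul1r mulrC.
(* [C * weight] dominates the second partial derivative. The factor 3 absorbs the translation by [s]
   with [|s| <= 1], and the factor 2 bounds the kernel. *)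
have [C hC] := rapid_weight (schwartz_rapid (schwartz_partial i pS)).
have wi : integrable_Rn (fun x : V => 2 * (3 * C * weight x)).
  by apply: integrable_RnZ; apply: integrable_RnZ; exact: integrable_weight.
have d2 : is_derive (0 : R) 1 F (hartley (partial i f) y).
  apply: (@is_derive_quadratic _ _ _ _ _ _
    (integral_Rn (fun x : V => 2 * (3 * C * weight x)))) => h h1.
  rewrite /GRing.scale/= mulr1 addr0.
  have E0 : F 0 = hartley f y.
    by rewrite /F /hartley; apply: eq_integral_Rn => x; rewrite scale0r addr0.
  have fsi := integrable_Rn_shift (h *: e) fi.
  have i1 := integrable_Rn_cms y fsi; have i2 := integrable_Rn_cms y fi.
  have i3 := integrable_Rn_cms y pi.
  have i4 := integrable_RnB i1 i2.
  rewrite E0 /F /hartley -integral_RnB// -integral_RnZ// -integral_RnB//; last first.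
    exact: integrable_RnZ.
  rewrite [leRHS]mulrC -integral_RnZ//; apply: ler_norm_integral_Rn.
  - by apply: integrable_Rn_measurable; apply: integrable_RnB => //; exact: integrable_RnZ.
  - exact: integrable_RnZ.
  move=> x; rewrite -mulrBl mulrA -mulrBl normrM.
  have -> : h ^+ 2 * (2 * (3 * C * weight x)) = (3 * C * weight x) * h ^+ 2 * 2 by ring.
  apply: ler_pM => //; last exact: ler_norm_cms.
  have D1 (s : R) : is_derive s 1 (fun s : R => f (x + s *: e)) (partial i f (x + s *: e)).
    by apply: is_derive_line; exact: is_derive_partial.
  have D2 (s : R) : is_derive s 1 (fun s : R => partial i f (x + s *: e))
      (partial i (partial i f) (x + s *: e)).
    by apply: is_derive_line; exact: is_derive_partial.
  have := @taylor_quadratic _ _ _ _ (3 * C * weight x) h D1 D2.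
  rewrite /= scale0r addr0; apply => s sh.
  have C0 : 0 <= C.
    have := le_trans (normr_ge0 _) (hC 0).
    by rewrite pmulr_lge0// weight_gt0.
  apply: le_trans (hC _) _; rewrite [3 * C]mulrC -mulrA ler_wpM2l//.
  exact: weight_shift (le_trans sh h1).
by have [_ <-] := d1; have [_ <-] := d2.
Qed.

End Hartley.

(** * Stability of the Schwartz space under the Hartley transform *)

Section HartleySchwartz.
Variables (R : realType) (n : nat).
Local Notation V := 'rV[R]_n.
Local Notation S := (@schwartz R n).
Implicit Types (f g : V -> R) (x y z v : V).

(** Absorbs the sign and the argument [- y] of the rules for derivatives and coordinates, so that
    both rules yield the transform of a Schwartz function at [y]. *)
Definition negreflect f : V -> R := fun x => -1 * f (- x).

Lemma schwartz_negreflect f : f \in S -> negreflect f \in S.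
Proof. by move=> fS; apply: schwartzZ; exact: (schwartz_reflect fS). Qed.

Lemma hartley_negreflect f y : f \in S -> hartley (negreflect f) y = - hartley f (- y).
Proof.
move=> fS; rewrite /negreflect hartleyZ ?mulN1r ?hartleyN//.
  exact: schwartz_measurable.
exact: (schwartz_integrable (schwartz_reflect fS)).
Qed.

Lemma hartley_coord f i y : f \in S ->
  y 0 i * hartley f y = hartley (negreflect (partial i f)) y.
Proof.
move=> fS; rewrite hartley_negreflect; last exact: schwartz_partial.
by rewrite hartley_partial// mxE opprK mulNr opprK.
Qed.

Lemma partial_hartley f i : f \in S ->
  partial i (hartley f) = hartley (negreflect (fun x => x 0 i * f x)).
Proof.
move=> fS; apply/funext => y.
rewrite hartley_negreflect; last exact: schwartz_coord.
have [_] := is_derive_hartley y (delta_mx 0 i) fS; rewrite /partial => ->.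
by under [X in hartley X]funext do rewrite dotv_delta.
Qed.

Lemma hartley_monomial f a : f \in S ->
  exists2 g, g \in S & forall y, monomial a y * hartley f y = hartley g y.
Proof.
rewrite /monomial; elim: (index_enum _) f => [|i s IH] f fS.
  by exists f => // y; rewrite big_nil mul1r.
have [g gS gE] := IH f fS.
have [h hS hE] : exists2 h, h \in S & forall y, y 0 i ^+ a i * hartley g y = hartley h y.
  elim: (a i) => [|m [h hS hE]]; first by exists g => // y; rewrite expr0 mul1r.
  exists (negreflect (partial i h)).
    exact/schwartz_negreflect/schwartz_partial.
  by move=> y; rewrite exprS -mulrA hE hartley_coord.
by exists h => // y; rewrite big_cons -mulrA gE hE.
Qed.

Lemma ler_norm_hartley f y : integrable_Rn f ->
  `|hartley f y| <= integral_Rn (fun x => 2 * `|f x|).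
Proof.
move=> fi; apply: ler_norm_integral_Rn => [||x].
- exact: integrable_Rn_measurable (integrable_Rn_cms _ fi).
- by apply: integrable_RnZ; exact: integrable_Rn_norm.
- by rewrite normrM mulrC ler_wpM2r// ler_norm_cms.
Qed.

Lemma rapid_hartley f : f \in S -> rapid (hartley f).
Proof.
move=> fS a; have [g gS gE] := hartley_monomial a fS.
exists (integral_Rn (fun x => 2 * `|g x|)) => y; rewrite gE.
exact: ler_norm_hartley (schwartz_integrable gS).
Qed.

(** Existence of partial derivatives does not give continuity, which is obtained here directly. The
    kernel is 2-Lipschitz, so the sum over [i] of the integrals of [2 * |x 0 i * f x|] is a
    Lipschitz constant for the sup norm. *)
Lemma hartley_lipschitz f : f \in S -> exists2 C : R, 0 <= C &
  forall y z (d : R), (forall i, `|y 0 i - z 0 i| <= d) ->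
    `|hartley f y - hartley f z| <= C * d.
Proof.
move=> fS; pose G x := \sum_(i < n) 2 * `|x 0 i * f x|.
have Gi : integrable_Rn G.
  apply: integrable_Rn_sum => i; apply: integrable_RnZ; apply: integrable_Rn_norm.
  exact/schwartz_integrable/schwartz_coord.
have fi := schwartz_integrable fS.
exists (integral_Rn G).
  apply: (le_trans (normr_ge0 (integral_Rn (fun x : V => 0 : R)))).
  apply: ler_norm_integral_Rn => //.
    by rewrite /measurable_Rn; exact: measurable_cst.
  by move=> x; rewrite normr0; apply: sumr_ge0 => i _; rewrite mulr_ge0.
move=> y z d hd; rewrite /hartley -integral_RnB; try exact: integrable_Rn_cms.
rewrite mulrC -integral_RnZ//; apply: ler_norm_integral_Rn.
- by apply: integrable_Rn_measurable; apply: integrable_RnB; exact: integrable_Rn_cms.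
- exact: integrable_RnZ.
move=> x; rewrite -mulrBr normrM.
apply: le_trans (ler_wpM2l (normr_ge0 _) (ler_norm_cms_sub _ _)) _.
have -> : dotv y x - dotv z x = \sum_(i < n) (y 0 i - z 0 i) * x 0 i.
  by rewrite /dotv -sumrB; apply: eq_bigr => i _; rewrite mulrBl.
rewrite /G mulr_sumr mulrA.
apply: le_trans (ler_wpM2l _ (ler_norm_sum _ _ _)) _; first by rewrite mulr_ge0.
rewrite mulr_sumr; apply: ler_sum => i _; rewrite !normrM.
rewrite (_ : d * _ = `|f x| * 2 * (d * `|x 0 i|)); last by ring.
by rewrite ler_wpM2l ?mulr_ge0// ler_wpM2r.
Qed.

Lemma continuous_hartley f : f \in S -> continuous (hartley f).
Proof.
move=> fS y; have [C C0 hC] := hartley_lipschitz fS.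
apply/(@cvgrPdist_le R R V (nbhs y) (nbhs_filter y)) => e e0.
have d0 : 0 < e / (C + 1) by rewrite divr_gt0// ltr_wpDl.
apply: (filterS _ (nbhsx_ballx y _ d0)) => z /= [_ yz].
have H i : `|y 0 i - z 0 i| <= e / (C + 1) by have := yz 0 i; exact: ltW.
apply: le_trans (hC _ _ _ H) _.
by rewrite mulrA ler_pdivrMr ?ltr_wpDl// mulrC ler_pM2l// lerDl.
Qed.

Lemma schwartz_hartley f : f \in S -> hartley f \in S.
Proof.
move=> fS; pose K h := exists2 g, g \in S & h = hartley g.
apply: (schwartz_coind (K := K)); last by exists f.
- by move=> _ [g gS ->]; exact: continuous_hartley.
- by move=> _ i x [g gS ->]; have [] := is_derive_hartley x (delta_mx 0 i) gS.
- move=> _ i [g gS ->]; rewrite partial_hartley//.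
  by eexists; last reflexivity; exact/schwartz_negreflect/schwartz_coord.
- by move=> _ [g gS ->]; exact: rapid_hartley.
Qed.

End HartleySchwartz.

(** * Gaussians *)

Section Gaussian.
Variables (R : realType) (n : nat) (a : R).
Hypothesis a0 : 0 < a.
Local Notation V := 'rV[R]_n.
Local Notation S := (@schwartz R n).
Implicit Types (f g : V -> R) (x y z v : V).

(** The factor 1/2 makes the transform exchange the parameters [a] and [a^-1], up to the mass. *)
Definition gauss x : R := expR (- (a / 2 * dotv x x)).

Lemma gaussE x : gauss x = \prod_(i < n) expR (- (a / 2 * x 0 i ^+ 2)).
Proof.
rewrite /gauss /dotv mulr_sumr -sumrN expR_sum.
by apply: eq_bigr => i _; rewrite expr2.
Qed.

Lemma gaussN x : gauss (- x) = gauss x.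
Proof. by rewrite /gauss dotvN dotvC dotvN opprK. Qed.

Lemma integral_gauss1 :
  (\int[@lebesgue_measure R]_x (expR (- (a / 2 * x ^+ 2)))%:E =
    (Num.sqrt (2 * pi / a))%:E)%E.
Proof.
(* The standard deviation of the centred normal law whose density is proportional to the
   integrand. *)
pose s : R := Num.sqrt a^-1.
have s2 : s ^+ 2 = a^-1 by rewrite sqr_sqrtr// invr_ge0 ltW.
have s0 : s != 0 by rewrite gt_eqF// sqrtr_gt0 invr_gt0.
have := integral_normal_pdf 0 s; rewrite normal_pdfE// => H.
have p0 : 0 < 2 * pi / a by rewrite divr_gt0// mulr_gt0// pi_gt0.
have pk : normal_peak s = (Num.sqrt (2 * pi / a))^-1.
  by rewrite /normal_peak s2; congr (Num.sqrt _)^-1; rewrite -mulr_natl; field; rewrite gt_eqF.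
have E (x : R) : normal_fun 0 s x = expR (- (a / 2 * x ^+ 2)).
  rewrite /normal_fun subr0 s2 -mulr_natr; congr expR; field; by rewrite gt_eqF.
have : (\int[@lebesgue_measure R]_x ((Num.sqrt (2 * pi / a))^-1%:E *
    (expR (- (a / 2 * x ^+ 2)))%:E) = 1)%E.
  by rewrite -H; apply: eq_integral => x _; rewrite -EFinM pk E.
have q0 : 0 < Num.sqrt (2 * pi / a) by rewrite sqrtr_gt0.
rewrite ge0_integralZl//; last first.
  by apply/measurable_EFinP; rewrite -(funext E); exact: measurable_normal_fun.
move=> /(congr1 (mule (Num.sqrt (2 * pi / a))%:E)).
by rewrite muleA -EFinM divff ?gt_eqF// mul1e mule1.
Qed.

Lemma continuous_gauss1 : continuous (fun r : R => expR (- (a / 2 * r ^+ 2))).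
Proof.
move=> r.
have H : - (a / 2 * s ^+ 2) @[s --> r] --> - (a / 2 * r ^+ 2).
  by apply: cvgN; apply: cvgM; [exact: cvg_cst|exact: exprn_continuous].
exact: (cvg_comp _ _ H (@continuous_expR R _)).
Qed.

Lemma integral_gauss : integral_Rn gauss = Num.sqrt (2 * pi / a) ^+ n.
Proof.
rewrite (funext gaussE).
have [|||_ ->] := @integral_prod_Rn R n (fun _ r => expR (- (a / 2 * r ^+ 2)))
  (fun=> Num.sqrt (2 * pi / a)).
- by move=> _; apply: continuous_measurable_fun; exact: continuous_gauss1.
- by move=> _ r; exact: expR_ge0.
- by move=> _; exact: integral_gauss1.
- by rewrite prodr_const card_ord.
Qed.

Lemma is_derive_gauss x i :
  is_derive x (delta_mx 0 i) gauss (- a * (x 0 i * gauss x)).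
Proof.
apply: is_derive_of_line; rewrite /gauss.
set e : V := delta_mx 0 i.
have E (r : R) : dotv (x + r *: e) (x + r *: e) = dotv x x + 2 * r * x 0 i + r ^+ 2.
  rewrite [x + _]addrC dotv_lin dotv_delta !mxE !eqxx dotvC dotv_lin dotv_delta.
  by rewrite mulr1; ring.
have d1 : is_derive (0 : R) 1
    (fun r : R => - (a / 2 * dotv (x + r *: e) (x + r *: e))) (- a * x 0 i).
  apply: (@is_derive_quadratic _ _ _ _ _ _ (a / 2)) => h _.
  rewrite /GRing.scale/= mulr1 addr0 !E.
  rewrite (_ : _ - _ - _ = - (a / 2 * h ^+ 2)); last by field.
  by rewrite normrN ger0_norm// mulr_ge0 ?sqr_ge0// divr_ge0// ltW.
rewrite (_ : - a * _ =
  expR (- (a / 2 * dotv (x + 0 *: e) (x + 0 *: e))) * (- a * x 0 i)).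
  exact: (@is_derive1_comp _ expR _ 0 _ _ (is_derive_expR _) d1).
by rewrite scale0r addr0; ring.
Qed.

Lemma ler_norm_exprM_gauss1 m : exists C : R, forall r : R,
  `|r ^+ m * expR (- (a / 2 * r ^+ 2))| <= C.
Proof.
exists (1 + m.+1`!%:R / (a / 2) ^+ m.+1) => r.
have c0 : 0 < a / 2 by rewrite divr_gt0.
set t := a / 2 * r ^+ 2; have t0 : 0 <= t by rewrite mulr_ge0 ?sqr_ge0// ltW.
rewrite expRN normrM normfV (gtr0_norm (expR_gt0 _)) ler_pdivrMr ?expR_gt0//.
have f0 : 0 < m.+1`!%:R :> R by rewrite ltr0n fact_gt0.
have h1 : (r ^+ 2) ^+ m.+1 <= m.+1`!%:R / (a / 2) ^+ m.+1 * expR t.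
  have := expR_ge1Dxn m t0; rewrite /t exprMn => H.
  rewrite mulrAC ler_pdivlMr ?exprn_gt0// mulrC [leRHS]mulrC -ler_pdivrMr//.
  by apply: le_trans H; rewrite lerDr.
have h2 : 1 <= expR t by rewrite -expR0 ler_expR.
rewrite mulrDl mul1r; apply: le_trans (lerD h2 h1).
rewrite normrX -[r ^+ 2]real_normK ?num_real// -exprM.
have [r1|r1] := leP `|r| 1.
  apply: (@le_trans _ _ 1); first exact: exprn_ile1.
  by rewrite lerDl exprn_ge0.
apply: (@le_trans _ _ (`|r| ^+ (2 * m.+1))); last by rewrite lerDr.
by apply: ler_weXn2l; [exact: ltW|exact: leq_trans (leqnSn m) (leq_pmull _ _)].
Qed.

Lemma rapid_gauss : rapid gauss.
Proof.
move=> m; have H i : {C : R | forall r : R,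
    `|r ^+ m i * expR (- (a / 2 * r ^+ 2))| <= C}.
  exact/cid/ler_norm_exprM_gauss1.
exists (\prod_(i < n) sval (H i)) => x.
rewrite gaussE /monomial -big_split normr_prod.
by apply: ler_prod => i _; rewrite normr_ge0/=; exact: (svalP (H i)).
Qed.

(** Polynomials times the Gaussian, given by generators so that the conditions of [schwartz_coind]
    follow by induction. *)
Inductive gauss_class : (V -> R) -> Prop :=
| gauss_class_gauss : gauss_class gauss
| gauss_class_coord i f : gauss_class f -> gauss_class (fun x => x 0 i * f x)
| gauss_class_scale c f : gauss_class f -> gauss_class (fun x => c * f x)
| gauss_class_add f g : gauss_class f -> gauss_class g ->
    gauss_class (fun x => f x + g x).

Lemma gauss_class_derive f i : gauss_class f -> exists2 g, gauss_class g &
  forall x, is_derive x (delta_mx 0 i) f (g x).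
Proof.
elim=> [|j {}f fK [g gK dg]|c {}f _ [g gK dg]|f1 f2 _ [g1 g1K dg1] _ [g2 g2K dg2]].
- exists (fun x => - a * (x 0 i * gauss x)); last by move=> x; exact: is_derive_gauss.
  by apply: gauss_class_scale; apply: gauss_class_coord; exact: gauss_class_gauss.
- exists (fun x => x 0 j * g x + (j == i)%:R * f x).
    by apply: gauss_class_add; [exact: gauss_class_coord|exact: gauss_class_scale].
  move=> x; have := is_deriveM (is_derive_coord j x (delta_mx 0 i)) (dg x).
  by rewrite mxE eqxx /= /GRing.scale/= [f x * _]mulrC.
- exists (fun x => c * g x); first exact: gauss_class_scale.
  by move=> x; exact: (is_deriveZ c (dg x)).
- exists (fun x => g1 x + g2 x); first exact: gauss_class_add.
  by move=> x; exact: (is_deriveD (dg1 x) (dg2 x)).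
Qed.

Lemma continuous_gauss : continuous gauss.
Proof.
rewrite (funext gaussE); elim: (index_enum _) => [|i s IH].
  rewrite (_ : (fun=> _) = cst 1); first exact: cst_continuous.
  by apply/funext => x; rewrite big_nil.
rewrite (_ : (fun=> _) = (fun x => expR (- (a / 2 * x 0 i ^+ 2)) *
    \prod_(j <- s) expR (- (a / 2 * x 0 j ^+ 2)))); last first.
  by apply/funext => x; rewrite big_cons.
move=> x.
have H : {for x, continuous (fun y : V => expR (- (a / 2 * y 0 i ^+ 2)))}.
  exact: (cvg_comp _ _ (@coord_continuous R 1 n 0 i x) (@continuous_gauss1 (x 0 i))).
exact: (cvgM H (IH x)).
Qed.

Lemma schwartz_gauss : gauss \in S.
Proof.
apply: (schwartz_coind (K := gauss_class)); last exact: gauss_class_gauss.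
- move=> f; elim=> [|j {}f fK IH|c {}f _ IH|f1 f2 _ IH1 _ IH2] x.
  + exact: continuous_gauss.
  + exact: (cvgM (@coord_continuous R 1 n 0 j x) (IH x)).
  + exact: (cvgM (cvg_cst c) (IH x)).
  + exact: (cvgD (IH1 x) (IH2 x)).
- by move=> f i x fK; have [g _ dg] := gauss_class_derive i fK; have [] := dg x.
- move=> f i fK; have [g gK dg] := gauss_class_derive i fK.
  rewrite (_ : partial i f = g)//; apply/funext => x.
  by have [_] := dg x.
- move=> f; elim=> [|j {}f fK IH|c {}f _ IH|f1 f2 _ IH1 _ IH2].
  + exact: rapid_gauss.
  + exact: rapid_coord.
  + exact: rapidZ.
  + exact: rapidD.
Qed.

Lemma partial_gauss i x : partial i gauss x = - a * (x 0 i * gauss x).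
Proof. by have [_] := is_derive_gauss x i. Qed.

Lemma hartley_at0 f : hartley f 0 = integral_Rn f.
Proof.
apply: eq_integral_Rn => x; rewrite /cms /dotv big1 => [|i _]; last first.
  by rewrite mxE mul0r.
by rewrite cos0 sin0 subr0 mulr1.
Qed.

(** Integration by parts: [hartley_partial] at [y = 0] says that the derivative of
    [x 0 i * gauss a x] has integral zero. *)
Lemma integral_gauss_coord2 i :
  integral_Rn (fun x => x 0 i ^+ 2 * gauss x) = a^-1 * integral_Rn gauss.
Proof.
have cS := schwartz_coord i schwartz_gauss.
have gi := schwartz_integrable schwartz_gauss.
have c2i := schwartz_integrable (schwartz_coord i cS).
have := hartley_partial i 0 cS; rewrite hartley_at0 mxE mul0r.
rewrite (@eq_integral_Rn _ _ _ (fun x => gauss x + (- a) * (x 0 i * (x 0 i * gauss x)))).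
  rewrite integral_RnD//; last exact: integrable_RnZ.
  rewrite integral_RnZ// mulNr => /eqP; rewrite subr_eq0 => /eqP ->.
  by rewrite mulKf ?gt_eqF//; apply: eq_integral_Rn => x; rewrite mulrA expr2.
move=> x; have [_ E] := is_derive_coordM i i x schwartz_gauss.
by rewrite /partial E partial_gauss eqxx mul1r; ring.
Qed.

Lemma hartley_coord_gauss i y :
  hartley (fun x => x 0 i * gauss x) y = - a^-1 * (y 0 i * hartley gauss (- y)).
Proof.
rewrite -hartley_partial ?schwartz_gauss//.
rewrite -hartleyZ; last exact/schwartz_integrable/schwartz_partial/schwartz_gauss.
congr hartley; apply/funext => x; rewrite partial_gauss.
by rewrite mulrA mulrNN mulVf ?mul1r// gt_eqF.
Qed.

Lemma hartley_gauss y :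
  hartley gauss y = integral_Rn gauss * expR (- (a^-1 / 2 * dotv y y)).
Proof.
pose phi (t : R) := hartley gauss (t *: y).
pose q := dotv y y.
(* The derivative along [y] is minus the transform of [dotv y x * gauss a x] at [- (t *: y)]. By
   [hartley_coord_gauss], each coordinate factor returns a multiple of the transform of the
   Gaussian, which closes the equation. *)
have dphi (t : R) : is_derive t 1 phi (- (t / a * q) * phi t).
  have := @is_derive_line _ _ (hartley gauss) 0 y t _
    (is_derive_hartley (0 + t *: y) y schwartz_gauss).
  rewrite (_ : (fun r : R => _) = phi); last by apply/funext => r; rewrite add0r.
  rewrite add0r (_ : - hartley _ _ = - (t / a * q) * phi t)//.
  rewrite (_ : (fun x => dotv y x * gauss x) =
      fun x => \sum_(i < n) y 0 i * (x 0 i * gauss x)); last first.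
    by apply/funext => x; rewrite /dotv mulr_suml; apply: eq_bigr => i _; rewrite mulrA.
  have ci i := schwartz_integrable (schwartz_coord i schwartz_gauss).
  rewrite hartley_sum => [|i]; last exact: integrable_RnZ.
  rewrite mulNr; congr (- _); rewrite /q /dotv mulr_sumr mulr_suml.
  apply: eq_bigr => i _; rewrite hartleyZ// hartley_coord_gauss opprK !mxE /phi.
  by field; rewrite gt_eqF.
(* [w] is an integrating factor for the differential equation of [phi]. *)
pose w (t : R) := expR (t ^+ 2 * (q / (2 * a))).
have dw (t : R) : is_derive t 1 w (w t * (t / a * q)).
  have d1 : is_derive t 1 (fun t : R => t ^+ 2 * (q / (2 * a))) (t / a * q).
    apply: (@is_derive_quadratic _ _ _ _ _ _ `|q / (2 * a)|) => h _.
    rewrite /GRing.scale/= mulr1 -[h ^+ 2]ger0_norm ?sqr_ge0// -normrM.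
    rewrite le_eqVlt; apply/orP; left; apply/eqP; congr `|_|.
    by field; rewrite gt_eqF.
  exact: (@is_derive1_comp _ expR _ t _ _ (is_derive_expR _) d1).
have dpsi (t : R) : is_derive t 1 (fun t => phi t * w t) 0.
  have := is_deriveM (dphi t) (dw t).
  rewrite (_ : _ + _ = 0)//.
  by rewrite /GRing.scale/=; ring.
have [c [_]] := mvt_origin 1 dpsi.
rewrite mulr0 => /eqP; rewrite subr_eq0 => /eqP.
rewrite /phi /w scale1r scale0r expr1n mul1r expr0n mul0r expR0 mulr1 hartley_at0 => <-.
rewrite -mulrA -expRD (_ : _ + _ = 0) ?expR0 ?mulr1//.
by rewrite /q; field; rewrite gt_eqF.
Qed.

End Gaussian.

(** * Inversion *)

Section FubiniRn.
Variables (R : realType) (n : nat).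
Local Notation V := 'rV[R]_n.
Local Notation mu := (lebesgue_measure_tuple R n).
Local Notation row := (@row_of_tuple R n).
Implicit Types (f g A B : V -> R) (x y z v : V) (k : V -> V -> R).

(** The majorant is [M * |A x| * |B y|]: the kernel is merely bounded, so both [A] and [B] must
    bring integrability. In the inversion, [B] gets it from the Gaussian. *)
Lemma fubini_Rn A B k (M : R) : integrable_Rn A -> integrable_Rn B ->
  measurable_fun setT (fun p : n.-tuple R * n.-tuple R => k (row p.1) (row p.2)) ->
  (forall x y, `|k x y| <= M) ->
  integral_Rn (fun x => A x * integral_Rn (fun y => B y * k x y)) =
  integral_Rn (fun y => B y * integral_Rn (fun x => A x * k x y)).
Proof.
move=> Ai Bi mk kM.
have mA := integrable_Rn_measurable Ai; have mB := integrable_Rn_measurable Bi.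
have kx s : measurable_fun setT (fun t => k (row s) (row t)).
  have mp : measurable_fun setT (fun t : n.-tuple R => (s, t)).
    exact: measurable_fun_pair.
  exact: (measurableT_comp mk mp).
have ky t : measurable_fun setT (fun s => k (row s) (row t)).
  have mp : measurable_fun setT (fun s : n.-tuple R => (s, t)).
    exact: measurable_fun_pair.
  exact: (measurableT_comp mk mp).
have MBi : integrable_Rn (fun y => M * `|B y|).
  by apply: integrable_RnZ; exact: integrable_Rn_norm.
have Bk s : integrable_Rn (fun y => B y * k (row s) y).
  apply: integrable_Rn_le MBi; first exact: measurable_funM.
  by move=> y; rewrite normrM mulrC ler_wpM2r.
have Ak t : integrable_Rn (fun x => A x * k x (row t)).
  apply: (integrable_Rn_le (g := fun x => M * `|A x|)).
  - exact: measurable_funM.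
  - by move=> x; rewrite normrM mulrC ler_wpM2r.
  - by apply: integrable_RnZ; exact: integrable_Rn_norm.
pose F (p : n.-tuple R * n.-tuple R) : R :=
  A (row p.1) * (B (row p.2) * k (row p.1) (row p.2)).
have mF : measurable_fun setT F.
  apply: measurable_funM; first exact: (measurableT_comp mA).
  by apply: measurable_funM => //; exact: (measurableT_comp mB).
have Fi : (mu \x mu)%E.-integrable setT (EFin \o F).
  pose G (p : n.-tuple R * n.-tuple R) : R := `|A (row p.1)| * (M * `|B (row p.2)|).
  have mG : measurable_fun setT G.
    apply: measurable_funM.
      apply: measurableT_comp => //; exact: (measurableT_comp mA).
    apply: measurable_funM => //.
    apply: measurableT_comp => //; exact: (measurableT_comp mB).
  apply: (@le_integrable _ _ _ _ _ _ _ (EFin \o G)) => //.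
  - exact/measurable_EFinP.
  - move=> p _; rewrite /F /G /= lee_fin !normrM !normr_id ler_wpM2l//.
    by rewrite mulrC ler_wpM2r// (le_trans (kM (row p.1) (row p.2)))// ler_norm.
  apply/integrable12ltyP; first exact/measurable_EFinP.
  have M0 : 0 <= M by apply: le_trans (kM 0 0).
  (* The inner integral of [G] is [c * |A|], so Tonelli reduces integrability of [G] to that of
     [A]. *)
  pose c := integral_Rn (fun y => M * `|B y|).
  have c0 : 0 <= c by apply: Rintegral_ge0 => t _; rewrite mulr_ge0.
  have /integrableP[_] := integrable_RnZ c (integrable_Rn_norm Ai).
  rewrite (eq_integral (fun s => \int[mu]_t `|(EFin \o G) (s, t)|)%E)//.
  move=> s _; rewrite /G /=.
  under [RHS]eq_integral => t _.
    rewrite ger0_norm ?mulr_ge0// EFinM.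
    over.
  rewrite integralZl//=.
  rewrite ger0_norm ?mulr_ge0// EFinM muleC; congr (_ * _)%E.
  by rewrite /c /integral_Rn /Rintegral fineK//; apply: integrable_fin_num.
have -> : integral_Rn (fun x => A x * integral_Rn (fun y => B y * k x y)) =
    fine (\int[mu]_s \int[mu]_t (EFin \o F) (s, t))%E.
  rewrite /integral_Rn /Rintegral; congr fine; apply: eq_integral => s _.
  rewrite -/(row _) /F /=.
  under [RHS]eq_integral do rewrite EFinM.
  rewrite integralZl//; last exact: Bk.
  by rewrite EFinM fineK//; apply: integrable_fin_num => //; exact: Bk.
rewrite Fubini//; rewrite /integral_Rn /Rintegral; congr fine; apply: eq_integral => s _.
rewrite -/(row _) /F /=.
under eq_integral => t _ do rewrite mulrCA EFinM.
rewrite integralZl//; last exact: Ak.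
by rewrite EFinM fineK//; apply: integrable_fin_num => //; exact: Ak.
Qed.

End FubiniRn.

Section Inversion.
Variables (R : realType) (n : nat).
Local Notation V := 'rV[R]_n.
Local Notation row := (@row_of_tuple R n).
Local Notation S := (@schwartz R n).
Implicit Types (f g : V -> R) (x y z v : V).

Lemma measurable_dotv_pair :
  measurable_fun setT (fun p : n.-tuple R * n.-tuple R => dotv (row p.2) (row p.1)).
Proof.
rewrite (_ : (fun p => _) = fun p => \sum_(i < n) tnth p.2 i * tnth p.1 i); last first.
  by apply/funext => p; apply: eq_bigr => i _; rewrite !mxE.
apply: measurable_sum => i; apply: measurable_funM.
  by apply: (measurableT_comp (@measurable_tnth _ _ n i)).
by apply: (measurableT_comp (@measurable_tnth _ _ n i)).
Qed.

(** [cms s * cms t] is [cos (s - t) - sin (s + t)]; adding the reflected product cancels the sine,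
    and both sides are [2 * cos (s - t)]. *)
Lemma cms_mulD (s t : R) :
  cms s * cms t + cms (- s) * cms (- t) = cms (s - t) + cms (t - s).
Proof.
by rewrite !cmsN /cms !cosB !sinB; ring.
Qed.

Lemma dotvBl x z y : dotv (x - z) y = dotv x y - dotv z y.
Proof. by rewrite /dotv -sumrB; apply: eq_bigr => i _; rewrite !mxE mulrBl. Qed.

Lemma dotv_ge0 x : 0 <= dotv x x.
Proof. by apply: sumr_ge0 => i _; rewrite -expr2 sqr_ge0. Qed.

Lemma gauss_le1 a x : 0 < a -> gauss a x <= 1.
Proof.
move=> a0; rewrite -expR0 ler_expR oppr_le0 mulr_ge0 ?dotv_ge0//.
by rewrite divr_ge0// ltW.
Qed.

Lemma integrable_Rn_gaussM f a z : 0 < a -> integrable_Rn f ->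
  integrable_Rn (fun x => f x * gauss a (x - z)).
Proof.
move=> a0 fi; apply: (integrable_Rn_le (g := fun x => `|f x|)).
- apply: measurable_RnM; first exact: integrable_Rn_measurable.
  apply: integrable_Rn_measurable; apply: integrable_Rn_shift.
  exact/schwartz_integrable/schwartz_gauss.
- by move=> x; rewrite normrM ler_piMr// ger0_norm ?expR_ge0// gauss_le1.
- exact: integrable_Rn_norm.
Qed.

(* Averaging over [y] and [- y] kills the part of the product of kernels that is
   odd in [y]. *)
Lemma integral_gauss_cms a x z : 0 < a ->
  integral_Rn (fun y : V => gauss a y * (cms (dotv y x) * cms (dotv z y))) =
  integral_Rn (@gauss R n a) * gauss a^-1 (x - z).
Proof.
move=> a0.
have gi := schwartz_integrable (schwartz_gauss n a0).
pose F y := gauss a y * (cms (dotv y x) * cms (dotv z y)).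
have Fi : integrable_Rn F.
  rewrite (_ : F = fun y => gauss a y * cms (dotv x y) * cms (dotv z y)).
    by apply: integrable_Rn_cms; exact: integrable_Rn_cms.
  by apply/funext => y; rewrite /F mulrA [dotv y x]dotvC.
have FNi : integrable_Rn (fun y => F (- y)).
  rewrite (_ : (fun _ => _) = fun y => gauss a y * cms (dotv (- x) y) * cms (dotv (- z) y)).
    by apply: integrable_Rn_cms; exact: integrable_Rn_cms.
  apply/funext => y; rewrite /F gaussN mulrA dotvN [dotv y x]dotvC [dotv z _]dotvC.
  by rewrite !dotvN [dotv y z]dotvC.
have : integral_Rn F + integral_Rn (fun y => F (- y)) =
    hartley (gauss a) (x - z) + hartley (gauss a) (z - x).
  rewrite -integral_RnD// /hartley -integral_RnD; try exact: integrable_Rn_cms.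
  apply: eq_integral_Rn => y; rewrite /F gaussN dotvN.
  rewrite [dotv z (- y)]dotvC dotvN -!mulrDr; congr (_ * _).
  by rewrite [dotv z y]dotvC cms_mulD !dotvBl ![dotv _ y]dotvC.
rewrite integral_Rn_opp; last exact: integrable_Rn_measurable.
rewrite !hartley_gauss// -/(gauss a^-1 _) -/(gauss a^-1 _).
rewrite -[z - x]opprB gaussN => H.
apply: (@mulIf _ 2) => //; rewrite !mulr_natr !mulr2n; exact: H.
Qed.

(** Within sup distance [d], continuity gives [eta]. Elsewhere some coordinate has size at least
    [d], so [dotv x x >= d ^+ 2] and the trivial bound [2 * M] is at most [K * dotv x x]. *)
Lemma continuous_bounded_quadratic f z (M eta : R) :
  {for z, continuous f} -> (forall x, `|f x| <= M) -> 0 < eta ->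
  exists2 K : R, 0 <= K & forall x, `|f (x + z) - f z| <= eta + K * dotv x x.
Proof.
move=> fz fM eta0.
have := (@cvgrPdist_le R R V (nbhs z) (nbhs_filter z) f (f z)).1 fz eta eta0.
rewrite near_nbhs => /(@nbhs_ballP R V)[d /= d0 hd].
have M0 : 0 <= M := le_trans (normr_ge0 _) (fM 0).
have d2 : 0 < d ^+ 2 by rewrite exprn_gt0.
have K0 : 0 <= 2 * M / d ^+ 2 by rewrite divr_ge0 ?mulr_ge0// ltW.
exists (2 * M / d ^+ 2) => // x.
have dx := dotv_ge0 x.
have [xd|] := pselect (forall i, `|x 0 i| < d).
  apply: (@le_trans _ _ eta); last by rewrite lerDl mulr_ge0.
  rewrite distrC; apply: hd; split => // i j.
  rewrite [i]ord1 /ball/= !mxE.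
  by rewrite (_ : _ - _ = - x 0 j) ?normrN; [exact: xd|ring].
move=> /existsNP[i /negP]; rewrite -leNgt => di.
have : d ^+ 2 <= dotv x x.
  apply: (@le_trans _ _ (x 0 i ^+ 2)).
    rewrite -[leRHS]real_normK ?num_real//; apply: lerXn2r => //.
    by rewrite nnegrE ltW.
  rewrite /dotv (bigD1 i)//= -expr2 lerDl.
  by apply: sumr_ge0 => j _; rewrite -expr2 sqr_ge0.
move=> dd; apply: (@le_trans _ _ (2 * M)).
  rewrite (le_trans (ler_normB _ _))// mulr_natl mulr2n.
  by apply: lerD; exact: fM.
apply: (@le_trans _ _ (2 * M / d ^+ 2 * dotv x x)); last by rewrite lerDr ltW.
by rewrite -mulrA ler_peMr ?mulr_ge0// mulrC ler_pdivlMr// mul1r.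
Qed.

(** The powers of [a] cancel between the two masses; this is the origin of the constant in
    [hartleyK]. *)
Lemma integral_gaussM a : 0 < a ->
  integral_Rn (@gauss R n a) * integral_Rn (@gauss R n a^-1) = (2 * pi) ^+ n.
Proof.
move=> a0; rewrite !integral_gauss ?invr_gt0// -exprMn; congr (_ ^+ n).
have p0 : 0 <= 2 * pi :> R by rewrite mulr_ge0// pi_ge0.
rewrite -sqrtrM ?divr_ge0// ?ltW// invrK.
rewrite (_ : 2 * pi / a * (2 * pi * a) = (2 * pi) ^+ 2).
  by rewrite sqrtr_sqr ger0_norm.
by field; rewrite gt_eqF.
Qed.

(* [gauss a^-1] has second moments [a] times its mass. *)
Lemma approximate_identity f z (eta K a : R) : 0 < a -> f \in S -> 
  (forall x, `|f (x + z) - f z| <= eta + K * dotv x x) ->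
  `|integral_Rn (fun x => f x * gauss a^-1 (x - z)) -
    f z * integral_Rn (@gauss R n a^-1)| <=
  (eta + K * n%:R * a) * integral_Rn (@gauss R n a^-1).
Proof.
move=> a0 fS hf; have ai0 : 0 < a^-1 by rewrite invr_gt0.
have gS := schwartz_gauss n ai0; have gi := schwartz_integrable gS.
have g2i (i : 'I_n) : integrable_Rn (fun x : V => x 0 i ^+ 2 * gauss a^-1 x).
  have := schwartz_integrable (schwartz_coord i (schwartz_coord i gS)).
  by under [X in integrable_Rn X]funext do rewrite mulrA -expr2.
pose h x := f x * gauss a^-1 (x - z).
have fi := schwartz_integrable fS.
have hi : integrable_Rn h by exact: integrable_Rn_gaussM.
have hsi : integrable_Rn (fun x => f (x + z) * gauss a^-1 x).
  have := integrable_Rn_shift z hi; rewrite /h.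
  by under [X in integrable_Rn X -> _]funext do rewrite addrK.
have -> : integral_Rn h = integral_Rn (fun x => f (x + z) * gauss a^-1 x).
  rewrite -(@integral_Rn_shift _ _ h z).
    by apply: eq_integral_Rn => x; rewrite /h addrK.
  exact: integrable_Rn_measurable.
rewrite -integral_RnZ// -integral_RnB//; last exact: integrable_RnZ.
have -> : (eta + K * n%:R * a) * integral_Rn (@gauss R n a^-1) =
    integral_Rn (fun x : V => eta * gauss a^-1 x +
      K * \sum_(i < n) x 0 i ^+ 2 * gauss a^-1 x).
  rewrite integral_RnD; last 2 first.
  - exact: integrable_RnZ.
  - by apply: integrable_RnZ; exact: integrable_Rn_sum.
  rewrite !integral_RnZ//; last exact: integrable_Rn_sum.
  rewrite integral_Rn_sum//.
  under eq_bigr do rewrite integral_gauss_coord2// invrK.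
  rewrite sumr_const card_ord -mulr_natl; ring.
apply: ler_norm_integral_Rn.
- by apply: integrable_Rn_measurable; apply: integrable_RnB => //; exact: integrable_RnZ.
- apply: integrable_RnD; first exact: integrable_RnZ.
  by apply: integrable_RnZ; exact: integrable_Rn_sum.
- move=> x; rewrite -mulrBl normrM [`|gauss _ _|]ger0_norm ?expR_ge0//.
  by rewrite -mulr_suml mulrA -mulrDl ler_wpM2r ?expR_ge0//; exact: hf.
Qed.

(** Fubini with [B y = gauss a y * cms (dotv z y)]. The inner integral over [y] is given by
    [integral_gauss_cms]: a Gaussian in [x] that concentrates at [z] as [a] tends to 0. *)
Lemma hartley_gauss_regularization f z a : 0 < a -> f \in S ->
  integral_Rn (fun y => hartley f y * cms (dotv z y) * gauss a y) =
  integral_Rn (@gauss R n a) * integral_Rn (fun x => f x * gauss a^-1 (x - z)).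
Proof.
move=> a0 fS; have fi := schwartz_integrable fS.
have gi := schwartz_integrable (schwartz_gauss n a0).
have gzi := integrable_Rn_cms z gi.
have mk : measurable_fun setT
    (fun p : n.-tuple R * n.-tuple R => cms (dotv (row p.2) (row p.1))).
  apply: (measurableT_comp (f := @cms R)); last exact: measurable_dotv_pair.
  by apply: continuous_measurable_fun; exact: continuous_cms.
have := fubini_Rn (k := fun x y => cms (dotv y x)) fi gzi mk (fun x y => ler_norm_cms _).
set L := integral_Rn (fun x => f x * _).
have <- : L = integral_Rn (@gauss R n a) * integral_Rn (fun x => f x * gauss a^-1 (x - z)).
  rewrite -integral_RnZ; last by apply: integrable_Rn_gaussM => //; rewrite invr_gt0.
  apply: eq_integral_Rn => x; rewrite mulrCA -integral_gauss_cms//.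
  by congr (_ * _); apply: eq_integral_Rn => y; rewrite mulrAC mulrA.
by move=> ->; apply: eq_integral_Rn => y; rewrite /hartley; ring.
Qed.

(** [1 - gauss a y] lies between 0 and [a / 2 * dotv y y], and the kernel bound 2 cancels the
    1/2. *)
Lemma gauss_regularization_error g z a : 0 < a -> g \in S ->
  `|integral_Rn (fun y => g y * cms (dotv z y) * gauss a y) - hartley g z| <=
  a * integral_Rn (fun y => `|dotv y y * g y|).
Proof.
move=> a0 gS; have gi := schwartz_integrable gS.
have gki := integrable_Rn_cms z gi.
have gkgi : integrable_Rn (fun y => g y * cms (dotv z y) * gauss a y).
  have := integrable_Rn_gaussM 0 a0 gki.
  by under [X in integrable_Rn X -> _]funext do rewrite subr0.
have dgi : integrable_Rn (fun y => `|dotv y y * g y|).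
  apply: integrable_Rn_norm.
  rewrite (_ : (fun _ => _) = fun y => \sum_(i < n) y 0 i * (y 0 i * g y)).
    apply: integrable_Rn_sum => i.
    exact/schwartz_integrable/schwartz_coord/schwartz_coord.
  by apply/funext => y; rewrite /dotv mulr_suml; apply: eq_bigr => i _; rewrite mulrA.
rewrite /hartley -integral_RnB// -integral_RnZ//.
apply: ler_norm_integral_Rn.
- by apply: integrable_Rn_measurable; exact: integrable_RnB.
- exact: integrable_RnZ.
move=> y; rewrite -[X in _ - X]mulr1 -mulrBr !normrM.
rewrite [`|gauss a y - 1|]distrC (ger0_norm (dotv_ge0 y)) [`|1 - _|]ger0_norm ?subr_ge0 ?gauss_le1//.
rewrite (_ : a * _ = `|g y| * 2 * (a / 2 * dotv y y)); last by field.
apply: ler_pM; rewrite ?mulr_ge0 ?subr_ge0 ?gauss_le1//.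
  by rewrite ler_wpM2l// ler_norm_cms.
by rewrite lerBlDr -lerBlDl; exact: expR_ge1Dx.
Qed.

Lemma hartleyK f z : f \in S -> hartley (hartley f) z = (2 * pi) ^+ n * f z.
Proof.
move=> fS; have gS := schwartz_hartley fS.
have [M fM] := schwartz_rapid fS (fun=> 0%N).
have {}fM x : `|f x| <= M.
  by have := fM x; rewrite /monomial big1 ?mul1r// => i _; rewrite expr0.
set c := (2 * pi) ^+ n.
have c0 : 0 <= c by rewrite exprn_ge0// mulr_ge0// pi_ge0.
pose C := integral_Rn (fun y => `|dotv y y * hartley f y|).
have key eta : 0 < eta -> exists K, forall a, 0 < a ->
    `|hartley (hartley f) z - c * f z| <= c * eta + K * a.
  move=> eta0.
  have [K K0 hK] := continuous_bounded_quadratic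
    (schwartz_continuous fS (x := z)) fM eta0.
  (* Removing the Gaussian costs [C * a]. The approximate identity costs [eta + K * n%:R * a] times
     both masses, whose product is [c]. [K] depends on [eta] but not on [a], so [eta] is fixed
     before [a]. *)
  exists (C + c * (K * n%:R)) => a a0.
  have h1 := gauss_regularization_error z a0 gS.
  have h2 := approximate_identity a0 fS hK.
  rewrite (hartley_gauss_regularization z a0 fS) in h1.
  rewrite -(integral_gaussM a0) in c c0 *.
  set J := integral_Rn (fun x => f x * gauss a^-1 (x - z)) in h1 h2.
  have g0 : 0 <= integral_Rn (@gauss R n a).
    by apply: Rintegral_ge0 => t _; exact: expR_ge0.
  have h3 := ler_wpM2l g0 h2.
  rewrite -[X in X * `|_|](ger0_norm g0) -normrM in h3.
  rewrite distrC in h1.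
  have := lerD h1 h3.
  move/(le_trans (ler_normD _ _)).
  rewrite (_ : hartley (hartley f) z - _ + _ = hartley (hartley f) z - c * f z); last first.
    by rewrite /c; ring.
  move/le_trans; apply; rewrite le_eqVlt; apply/orP; left; apply/eqP.
  by rewrite /c /C; ring.
apply/eqP; rewrite -subr_eq0 -normr_le0; apply/ler_addgt0Pl => e e0.
rewrite addr0.
(* This value of [eta] makes the first error at most [e / 2], and [a = e / 2 / (|K| + 1)] does so
   for the second; adding 1 keeps the denominators positive. *)
have e1 : 0 < e / 2 / (c + 1) by rewrite !divr_gt0// ltr_wpDl.
have [K hK] := key _ e1.
have k0 : 0 < `|K| + 1 by rewrite ltr_wpDl.
have e2 : 0 < e / 2 / (`|K| + 1) by rewrite !divr_gt0.
apply: le_trans (hK _ e2) _; rewrite [leRHS]splitr; apply: lerD.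
  rewrite mulrA ler_pdivrMr ?ltr_wpDl// mulrC ler_pM2l ?divr_gt0//.
  by rewrite lerDl.
rewrite mulrA ler_pdivrMr// mulrC ler_pM2l ?divr_gt0//.
by rewrite (le_trans (ler_norm K))// lerDl.
Qed.

End Inversion.

(** * The real Fourier operators as normalised Hartley transforms *)

Section RealFourierOperators.
Variables (R : realType) (n : nat).
Local Notation V := 'rV[R]_n.
Local Notation S := (@schwartz R n).
Implicit Types (f : schwartz_space R n) (g : schwartz_sa R n) (x y : V).

Definition hartley_transform f : schwartz_space R n :=
  SchwartzSpace (schwartzZ (Num.sqrt ((2 * pi) ^+ n))^-1 (schwartz_hartley (valP f))).

Lemma schwartz_space_integrable f : integrable_Rn f.
Proof. exact: schwartz_integrable (valP f). Qed.

Lemma hartley_transform_is_linear : linear hartley_transform.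
Proof.
move=> a f h; apply/val_inj/funext => y /=.
rewrite !fctE /= /GRing.scale/= (hartleyD (f := fun x => a * f x)) ?hartleyZ.
- by rewrite mulrDr mulrCA.
- exact: schwartz_space_integrable.
- by apply: integrable_RnZ; exact: schwartz_space_integrable.
- exact: schwartz_space_integrable.
Qed.

HB.instance Definition _ :=
  GRing.isLinear.Build R (schwartz_space R n) (schwartz_space R n) _
    hartley_transform hartley_transform_is_linear.

Lemma hartley_transformK : involutive hartley_transform.
Proof.
move=> f; apply/val_inj/funext => y /=.
have p0 : 0 < (2 * pi) ^+ n :> R by rewrite exprn_gt0// mulr_gt0// pi_gt0.
rewrite hartleyZ; last exact/schwartz_integrable/schwartz_hartley/(valP f).
rewrite hartleyK; last exact: (valP f).
rewrite !mulrA -invfM -expr2 sqr_sqrtr ?ltW// mulVf ?mul1r//.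
by rewrite gt_eqF.
Qed.

Lemma parity_sumK f : parity_sum (parity_decomposition f) = f.
Proof.
apply/val_inj/funext => x /=; rewrite !fctE /= /GRing.scale/=.
by field.
Qed.

(** Replacing [y] by [- y] turns the kernel [cos - sin] into [cos + sin], so the even part of the
    transform keeps the cosine and the odd part keeps minus the sine. *)
Lemma parity_decomposition_hartley f y :
  (parity_decomposition (hartley_transform f)).1 y = fourier_cos f y /\
  (parity_decomposition (hartley_transform f)).2 y = fourier_sin f y.
Proof.
have fi := schwartz_space_integrable f.
have i1 := integrable_Rn_cms y fi; have i2 := integrable_Rn_cms (- y) fi.
split; rewrite /= !fctE /= /GRing.scale/= ?mulNr -?mulrBr -?mulrDr mulrCA.
- congr (_ * _); rewrite /hartley -integral_RnD// -integral_RnZ; last exact: integrable_RnD.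
  apply: eq_integral_Rn => x; rewrite dotvN cmsN /cms; by field.
- rewrite /fourier_sin mulNr -mulrN; congr (_ * _).
  have E x : f x * sin (dotv y x) =
      - 2^-1 * (f x * cms (dotv y x) - f x * cms (dotv (- y) x)).
    by rewrite dotvN cmsN /cms; field.
  rewrite (eq_integral_Rn E) integral_RnZ; last exact: integrable_RnB.
  by rewrite integral_RnB// mulNr opprK.
Qed.

Lemma hartley_parity_sum g x :
  hartley_transform (parity_sum g) x = fourier_anti g.1 g.2 x.
Proof.
case: g => -[g1 g2] /= gP; have := gP; rewrite inE /= => -[e1 e2].
have i1 := schwartz_space_integrable g1; have i2 := schwartz_space_integrable g2.
rewrite /fourier_anti; congr (_ * _).
pose h y := (g1 y + g2 y) * cms (dotv x y).
have hi : integrable_Rn h by apply: integrable_Rn_cms; exact: integrable_RnD.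
rewrite -[LHS]/(integral_Rn h).
have hN y : h (- y) = (g1 y - g2 y) * (cos (dotv x y) + sin (dotv x y)).
  rewrite /h dotvC dotvN [dotv y x]dotvC cmsN; congr (_ * _).
  by rewrite -e1 [g2 y]e2 opprK.
have hNi : integrable_Rn (fun y => h (- y)).
  rewrite (_ : (fun _ => _) = fun y => (g1 y - g2 y) * cms (dotv (- x) y)).
    by apply: integrable_Rn_cms; exact: integrable_RnB.
  by apply/funext => y; rewrite hN dotvN cmsN.
have E := integral_Rn_opp (integrable_Rn_measurable hi).
(* Averaging over reflection removes the cross terms: by the parities of [g1] and [g2],
   [h y + h (- y)] is twice the integrand of [fourier_anti]. *)
rewrite (_ : integral_Rn h = 2^-1 * (integral_Rn h + integral_Rn (fun y => h (- y)))).
  rewrite -integral_RnD// -integral_RnZ; last exact: integrable_RnD.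
  apply: eq_integral_Rn => y; rewrite hN /h /cms [dotv y x]dotvC; by field.
by rewrite E; field.
Qed.

End RealFourierOperators.

Theorem theorem1 (R : realType) (n : nat) (n_gt0 : (0 < n)%N) :
  exists (F : {linear schwartz_space R n -> schwartz_sa R n})
         (Fa : {linear schwartz_sa R n -> schwartz_space R n}),
    [/\ forall (f : schwartz_space R n) (y : 'rV[R]_n),
          (F f).1 y = fourier_cos f y /\ (F f).2 y = fourier_sin f y,
        forall (g : schwartz_sa R n) (x : 'rV[R]_n),
          Fa g x = fourier_anti g.1 g.2 x
      & let FR : {linear schwartz_space R n -> schwartz_space R n} :=
          @parity_sum R n \o F in
        let FRa : {linear schwartz_space R n -> schwartz_space R n} :=
          Fa \o @parity_decomposition R n in
        [/\ bijective FR, bijective FRa,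
            FRa \o FR = idfun & FR \o FRa = idfun]].
Proof.
exists (@parity_decomposition R n \o @hartley_transform R n).
exists (@hartley_transform R n \o @parity_sum R n).
split; [exact: parity_decomposition_hartley|exact: hartley_parity_sum|].
move=> FR FRa.
have FRE f : FR f = hartley_transform f by rewrite /FR /= parity_sumK.
have FRaE f : FRa f = hartley_transform f by rewrite /FRa /= parity_sumK.
have FRK : cancel FR FRa by move=> f; rewrite FRaE FRE hartley_transformK.
have FRaK : cancel FRa FR by move=> f; rewrite FRaE FRE hartley_transformK.
split; [by exists FRa|by exists FR|exact/funext|exact/funext].
Qed.
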